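(* Let $d\ge 1$, let $\mathcal I$ be a finite set of labels, $\eta_0\in\mathcal I$, and let $p_0=\sum_{\eta\in\mathcal I} w_\eta p_\eta$ be a mixture distribution on $\mathbb R^d$ with weights $w_\eta\ge 0$, $\sum_{\eta} w_\eta=1$, $w_{\eta_0}>0$, where each $p_\eta$ is a probability density supported on a convex compact set $K_\eta\subseteq\mathbb R^d$ having at least one interior point, $K_\eta\cap K_{\eta'}=\emptyset$ for all $\eta\neq\eta'$, and $\inf_{x\in K_{\eta_0}}p_{\eta_0}(x)>0$. Let $T>0$ and let $\gamma\ge 1$. Then there exists $\kappa_0>0$ depending only on $(p_0,\gamma)$ such that for all $\kappa\in(0,1)$ with $\kappa\le\kappa_0$ the following holds. For any sequence $\{t_k\}_{k\ge 0}$ with $t_0=0$, $0\le t_k<t_{k+1}<T$, $t_k\to T$ as $k\to\infty$, and step sizes $\Delta_k=t_{k+1}-t_k$ satisfying $\Delta_k\le\kappa\min\{1,T-t_{k+1}\}$ for all $k$, and for any initialization $\hat x_{t_0}\in\mathbb R^d$, the sequence defined by $$\hat x_{t_{k+1}}=e^{\Delta_k}\hat x_{t_k}+(e^{\Delta_k}-1)\big(\nabla\log p_{T-t_k}(\hat x_{t_k})+\gamma\nabla\log p_{T-t_k}(\eta_0\mid\hat x_{t_k})\big),\qquad k\ge 0,$$ satisfies $$\lim_{k\to\infty}\operatorname{dist}(\hat x_{t_k},K_{\eta_0})=0 .$$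
   Context: For $t>0$ set $\lambda_t=e^{-t}$, $\sigma_t=\sqrt{1-\lambda_t^2}$, $\phi_t(z)=(\sqrt{2\pi}\,\sigma_t)^{-d}\exp(-\|z\|^2/(2\sigma_t^2))$, and $$p_t(x)=\sum_{\eta\in\mathcal I}w_\eta\int p_\eta(u)\,\phi_t(x-\lambda_t u)\,\mathrm d u,\qquad p_t(\eta_0\mid x)=\frac{w_{\eta_0}\int p_{\eta_0}(u)\,\phi_t(x-\lambda_t u)\,\mathrm d u}{p_t(x)} .$$ All gradients are with respect to $x$. $\|\cdot\|$ is the Euclidean norm and $\operatorname{dist}(x,A)=\inf_{y\in A}\|x-y\|$. *)

(* Defs.v *)
From HB Require Import structures.
From mathcomp Require Import all_boot all_order all_algebra.
From mathcomp Require Import all_classical all_reals all_analysis.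

Set Implicit Arguments.
Unset Strict Implicit.
Unset Printing Implicit Defensive.

Import Order.TTheory GRing.Theory Num.Theory.
Import numFieldNormedType.Exports.

Local Open Scope classical_set_scope.
Local Open Scope ring_scope.

(* The sigma-algebra on 'rV[R]_n generated by the coordinates (equivalently,
   the Borel sigma-algebra of R^n). *)
Section measurable_rV.
Context {R : realType} (n : nat).

Let coords : 'I_n -> 'rV[R]_n -> measurableTypeR R := fun i u => u ord0 i.

Let rV_set0 : g_sigma_preimage coords set0.
Proof. exact: sigma_algebra0. Qed.

Let rV_setC A : g_sigma_preimage coords A -> g_sigma_preimage coords (~` A).
Proof. exact: sigma_algebraC. Qed.

Let rV_bigcup (F : (set 'rV[R]_n)^nat) :
  (forall i, g_sigma_preimage coords (F i)) ->
  g_sigma_preimage coords (\bigcup_i F i).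
Proof. exact: sigma_algebra_bigcup. Qed.

HB.instance Definition _ := @isMeasurable.Build default_measure_display
  'rV[R]_n (g_sigma_preimage coords) rV_set0 rV_setC rV_bigcup.

Lemma measurable_coord (i : 'I_n) :
  measurable_fun [set: 'rV[R]_n] (fun u => u ord0 i : measurableTypeR R).
Proof.
move=> _ Y mY; rewrite setTI; apply: sub_sigma_algebra => /=.
rewrite -bigcup_seq/=; exists i => /=; first by rewrite mem_index_enum.
by exists Y => //; rewrite setTI.
Qed.

Lemma measurable_fun_rV d (T : measurableType d) (f : T -> 'rV[R]_n) :
  (forall i, measurable_fun [set: T]
     (fun x => f x ord0 i : measurableTypeR R)) ->
  measurable_fun [set: T] f.
Proof.
move=> mf _ A mA; rewrite setTI.
suff : g_sigma_preimage coords `<=` [set B | measurable (f @^-1` B)].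
  by apply.
apply: smallest_sub.
  split => /=.
  - by rewrite preimage_set0; exact: measurable0.
  - by move=> B mB; rewrite setTD preimage_setC; exact: measurableC.
  - by move=> F mF; rewrite preimage_bigcup; exact: bigcupT_measurable.
rewrite -bigcup_seq; apply: bigcup_sub => i _ _ [B mB <-] /=.
rewrite setTI.
by rewrite -[X in measurable X]setTI; exact: mf.
Qed.

End measurable_rV.

Section lebesgue_measure_rV.
Context {R : realType}.

Definition rV_cons n (p : measurableTypeR R * 'rV[R]_n) : 'rV[R]_n.+1 :=
  row_mx (p.1 : R)%:M p.2.

Definition rV_uncons n (u : 'rV[R]_n.+1) : measurableTypeR R * 'rV[R]_n :=
  (u ord0 ord0, \row_i u ord0 (lift ord0 i)).

Lemma rV_cons0 n (p : measurableTypeR R * 'rV[R]_n) :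
  rV_cons p ord0 ord0 = p.1.
Proof.
transitivity (row_mx ((p.1 : R)%:M : 'M[R]_1) p.2 ord0 (lshift n ord0)).
  by congr (row_mx _ _ _ _); exact/val_inj.
by rewrite row_mxEl mxE eqxx.
Qed.

Lemma rV_consS n (p : measurableTypeR R * 'rV[R]_n) (i : 'I_n) :
  rV_cons p ord0 (lift ord0 i) = p.2 ord0 i.
Proof.
transitivity (row_mx ((p.1 : R)%:M : 'M[R]_1) p.2 ord0 (rshift 1 i)).
  by congr (row_mx _ _ _ _); exact/val_inj.
by rewrite row_mxEr.
Qed.

Lemma rV_consK n : cancel (@rV_cons n) (@rV_uncons n).
Proof.
case=> a u; rewrite /rV_uncons rV_cons0; congr pair.
by apply/rowP => i; rewrite mxE rV_consS.
Qed.

Lemma rV_unconsK n : cancel (@rV_uncons n) (@rV_cons n).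
Proof.
move=> u; apply/rowP => i; case: (unliftP ord0 i) => [j|] ->.
  by rewrite rV_consS mxE.
by rewrite rV_cons0.
Qed.

Lemma measurable_rV_cons n : measurable_fun setT (@rV_cons n).
Proof.
apply: measurable_fun_rV => i; case: (unliftP ord0 i) => [j|] ->.
  rewrite (_ : (fun _ => _) =
    (fun u : 'rV[R]_n => u ord0 j : measurableTypeR R) \o snd).
    by apply: measurableT_comp => //; exact: measurable_coord.
  by apply/funext => p /=; rewrite rV_consS.
rewrite (_ : (fun _ => _) = fst); first exact: measurable_fst.
by apply/funext => q /=; rewrite rV_cons0.
Qed.

Lemma measurable_rV_uncons n : measurable_fun setT (@rV_uncons n).
Proof.
rewrite /rV_uncons; apply: measurable_fun_pair; first exact: measurable_coord.
apply: measurable_fun_rV => i /=.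
rewrite (_ : (fun _ => _) =
  (fun u : 'rV[R]_n.+1 => u ord0 (lift ord0 i) : measurableTypeR R)).
  exact: measurable_coord.
by apply/funext => u /=; rewrite mxE.
Qed.

Section cons_measure.
Local Open Scope ereal_scope.
Variables (n : nat) (mu : {sigma_finite_measure set 'rV[R]_n -> \bar R}).

Definition cons_measure : set 'rV[R]_n.+1 -> \bar R :=
  pushforward (lebesgue_measure \x mu) (@rV_cons n).

Let cons_measure0 : cons_measure set0 = 0.
Proof. by rewrite /cons_measure /pushforward preimage_set0 measure0. Qed.

Let cons_measure_ge0 A : 0 <= cons_measure A.
Proof. by rewrite /cons_measure /pushforward; exact: measure_ge0. Qed.

Let cons_measure_sigma_additive : semi_sigma_additive cons_measure.
Proof.
have mc := @measurable_rV_cons n.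
move=> F mF tF mUF; rewrite /cons_measure /pushforward preimage_bigcup.
apply: measure_semi_sigma_additive.
- by move=> k; rewrite -[X in measurable X]setTI; exact: mc.
- apply/trivIsetP => /= i j _ _ ij; rewrite -preimage_setI.
  by move/trivIsetP : tF => /(_ _ _ _ _ ij) ->//; rewrite preimage_set0.
- by rewrite -preimage_bigcup -[X in measurable X]setTI; exact: mc.
Qed.

HB.instance Definition _ := isMeasure.Build _ _ _ cons_measure
  cons_measure0 cons_measure_ge0 cons_measure_sigma_additive.

Let cons_measure_sigma_finite : sigma_finite setT cons_measure.
Proof.
have /sigma_finiteP[F [TF ndF Foo]] := sigma_finiteT (@lebesgue_measure R).
have /sigma_finiteP[G [TG ndG Goo]] := sigma_finiteT mu.
exists (fun k => @rV_uncons n @^-1` (F k `*` G k)).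
  rewrite -preimage_bigcup -[LHS](preimage_setT (@rV_uncons n)); congr (_ @^-1` _).
  rewrite -setXTT TF TG predeqE => -[x y]; split.
    move=> [/= [i _ Fix] [j _ Gjy]]; exists (maxn i j) => //; split.
      by move: x Fix; exact/subsetPset/ndF/leq_maxl.
    by move: y Gjy; exact/subsetPset/ndG/leq_maxr.
  by move=> [k _ [/= Fx Gy]]; split; exists k.
move=> k; have [mF Fk] := Foo k; have [mG Gk] := Goo k; split.
  rewrite -[X in measurable X]setTI; apply: measurable_rV_uncons => //.
  exact: measurableX.
rewrite /cons_measure /pushforward -comp_preimage.
rewrite (_ : _ @^-1` _ = F k `*` G k); last first.
  by apply/seteqP; split => p; rewrite /preimage /mkset /comp rV_consK.
by rewrite product_measure1E// lte_mul_pinfty// ge0_fin_numE.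
Qed.

HB.instance Definition _ := Measure_isSigmaFinite.Build _ _ _ cons_measure
  cons_measure_sigma_finite.

End cons_measure.

(* n-dimensional Lebesgue measure: the n-fold product of lebesgue_measure,
   carried to row vectors one coordinate at a time. *)
Fixpoint lebesgue_rV (n : nat) : {sigma_finite_measure set 'rV[R]_n -> \bar R} :=
  match n with
  | 0 => \d_(0 : 'rV[R]_0)
  | m.+1 => cons_measure (lebesgue_rV m)
  end.

Lemma lebesgue_rV_box n (A : 'I_n -> set (measurableTypeR R)) :
  (forall i, measurable (A i)) ->
  (lebesgue_rV n [set u | forall i, A i (u ord0 i)] =
   \big[*%E/1%E]_(i < n) lebesgue_measure (A i))%E.
Proof.
elim: n A => [A _|n IH A mA] /=.
  by rewrite big_ord0 diracE mem_set// => -[].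
rewrite big_ord_recl -IH//.
set B := (X in lebesgue_rV n X).
have mB : measurable B.
  rewrite (_ : B = \bigcap_(i in [set: 'I_n])
    ((fun u : 'rV[R]_n => u ord0 i : measurableTypeR R) @^-1` A (lift ord0 i))).
    apply: fin_bigcap_measurable => // i _.
    by rewrite -[X in measurable X]setTI; exact: measurable_coord.
  by apply/seteqP; split => u /= Bu i; [move=> _|]; exact: Bu.
rewrite -product_measure1E//.
rewrite /cons_measure /pushforward; congr (_ _).
apply/seteqP; split => p /=.
  move=> Ap; split; first by have := Ap ord0; rewrite rV_cons0.
  by move=> i; have := Ap (lift ord0 i); rewrite rV_consS.
move=> [A0 AS] i; case: (unliftP ord0 i) => [j|] ->.
  by rewrite rV_consS.
by rewrite rV_cons0.
Qed.

End lebesgue_measure_rV.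

Section diffusion_guidance.
Context {R : realType} {d : nat}.
Implicit Types (t : R) (x z u : 'rV[R]_d) (A : set 'rV[R]_d).

(* The library norm on 'rV[R]_d is the sup norm. *)
Definition enorm z : R := Num.sqrt (\sum_(i < d) z ord0 i ^+ 2).

Definition edistance x A : R := inf [set enorm (x - y) | y in A].

Definition grad (f : 'rV[R]_d -> R) x : 'rV[R]_d :=
  \row_(i < d) 'D_(delta_mx ord0 i) f x.

Definition prob_density (p : 'rV[R]_d -> R) : Prop :=
  [/\ measurable_fun setT p, forall x, 0 <= p x &
      (\int[lebesgue_rV d]_x (p x)%:E = 1)%E].

Definition lam t : R := expR (- t).

Definition sig t : R := Num.sqrt (1 - lam t ^+ 2).

Definition gauss_kernel t z : R :=
  (Num.sqrt (2 * pi) * sig t) ^- d * expR (- (enorm z ^+ 2 / (2 * sig t ^+ 2))).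

Definition noised (p : 'rV[R]_d -> R) t x : R :=
  \int[lebesgue_rV d]_u (p u * gauss_kernel t (x - lam t *: u)).

Section mixture.
Context {I : finType} (w : I -> R) (p : I -> 'rV[R]_d -> R).

Definition mixture t x : R := \sum_eta w eta * noised (p eta) t x.

Definition posterior (eta0 : I) t x : R :=
  w eta0 * noised (p eta0) t x / mixture t x.

End mixture.

End diffusion_guidance.

(* Main.v *)
(* Put s = T - t and y = e^s x. The score of the noised mixture is the posterior
   mean of the clean sample up to an affine map, so one guided Euler step reads
   y+ = (1 - b) y + b (m0 + (gamma - 1) (m0 - m)), where m0 and m are the
   posterior means under p_eta0 and under the mixture, and
   b = (1 - e^-Delta) / sigma_s^2 = O(kappa).

   Let P be the projection of y onto the convex set K_eta0, which contains m0.
   A point u of another support K_eta with |y - u|^2 <= |y - P|^2 + eps satisfies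
   (y - P).(u - P) >= (|u - P|^2 - eps) / 2, which is bounded below by the gap g
   between the supports; all other points of K_eta are exponentially unlikely as
   s -> 0, because p_eta0 is bounded below near P on a set of volume bounded below.
   Hence (y - P).(m0 - m) <= - (g / 2) Q + o(1), where Q is the posterior mass of
   the labels other than eta0. Since |m0 - m|^2 = O(Q), the quadratic term of the
   Euler step is absorbed when kappa is small, and D = dist(y, K_eta0)^2 satisfies
   D+ <= (1 - b) D + b o(1). As 1 - b_k <= (s_(k+1) / s_k)^(1/8) and s_k -> 0,
   D tends to 0. *)
Require Import Defs.
From mathcomp Require Import all_boot all_order all_algebra.
From mathcomp Require Import all_classical all_reals all_analysis.
From mathcomp Require Import measurable_realfun lebesgue_integral_under.
From mathcomp Require Import ring lra.
Import Order.TTheory GRing.Theory Num.Theory.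
Import numFieldNormedType.Exports.
Local Open Scope classical_set_scope.
Local Open Scope ring_scope.

Set Implicit Arguments.
Unset Strict Implicit.
Unset Printing Implicit Defensive.

(** * The Euclidean inner product *)

Section dot_product.
Context {R : realType} {d : nat}.
Implicit Types u v z : 'rV[R]_d.

Definition dot u v : R := \sum_(i < d) u ord0 i * v ord0 i.

Lemma dotC u v : dot u v = dot v u.
Proof. by apply: eq_bigr => i _; rewrite mulrC. Qed.

Lemma dotDr z u v : dot z (u + v) = dot z u + dot z v.
Proof. by rewrite -big_split; apply: eq_bigr => i _; rewrite mxE mulrDr. Qed.

Lemma dotZr a u v : dot u (a *: v) = a * dot u v.
Proof. by rewrite mulr_sumr; apply: eq_bigr => i _; rewrite mxE mulrCA. Qed.

Lemma dotNr u v : dot u (- v) = - dot u v.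
Proof. by rewrite -scaleN1r dotZr mulN1r. Qed.

Lemma dotBr z u v : dot z (u - v) = dot z u - dot z v.
Proof. by rewrite dotDr dotNr. Qed.

Lemma dotDl z u v : dot (u + v) z = dot u z + dot v z.
Proof. by rewrite !(dotC _ z) dotDr. Qed.

Lemma dotZl a u v : dot (a *: u) v = a * dot u v.
Proof. by rewrite dotC dotZr dotC. Qed.

Lemma dotBl z u v : dot (u - v) z = dot u z - dot v z.
Proof. by rewrite !(dotC _ z) dotBr. Qed.

Lemma dot_sumr (J : Type) (r : seq J) (P : pred J) z (F : J -> 'rV[R]_d) :
  dot z (\sum_(j <- r | P j) F j) = \sum_(j <- r | P j) dot z (F j).
Proof.
elim/big_rec2 : _ => [|j x y _ <-]; last by rewrite dotDr.
by rewrite /dot big1// => i _; rewrite mxE mulr0.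
Qed.

Lemma dot_ge0 u : 0 <= dot u u.
Proof. by apply: sumr_ge0 => i _; rewrite -expr2 sqr_ge0. Qed.

Lemma dot_eq0 u : dot u u = 0 -> u = 0.
Proof.
move=> u0; apply/rowP => i; rewrite mxE.
have /eqP := u0; rewrite /dot psumr_eq0; last first.
  by move=> j _; rewrite -expr2 sqr_ge0.
by move=> /allP/(_ i (mem_index_enum _)) /=; rewrite mulf_eq0 orbb => /eqP.
Qed.

Lemma enorm_sqr u : enorm u ^+ 2 = dot u u.
Proof.
rewrite /enorm sqr_sqrtr; last by apply: sumr_ge0 => i _; rewrite sqr_ge0.
by apply: eq_bigr => i _; rewrite expr2.
Qed.

Lemma enormE u : enorm u = Num.sqrt (dot u u).
Proof. by rewrite /enorm; congr Num.sqrt; apply: eq_bigr => i _; rewrite expr2. Qed.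

Lemma dot_le_coord u (C : R) : (forall i, `|u ord0 i| <= C) ->
  dot u u <= C ^+ 2 *+ d.
Proof.
move=> uC; rewrite -[X in _ *+ X]card_ord -sumr_const; apply: ler_sum => i _.
by rewrite -expr2 -real_normK ?num_real// lerXn2r ?nnegrE ?(le_trans _ (uC i)).
Qed.

Lemma dotDD_le u v : dot (u + v) (u + v) <= 2 * dot u u + 2 * dot v v.
Proof.
rewrite !mulr_sumr -big_split /=; apply: ler_sum => i _; rewrite !mxE -subr_ge0.
have -> : 2 * (u ord0 i * u ord0 i) + 2 * (v ord0 i * v ord0 i) -
  (u ord0 i + v ord0 i) * (u ord0 i + v ord0 i) = (u ord0 i - v ord0 i) ^+ 2.
  by ring.
exact: sqr_ge0.
Qed.

Lemma continuous_dot (T : topologicalType) (f g : T -> 'rV[R]_d) :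
  continuous f -> continuous g -> continuous (fun x => dot (f x) (g x)).
Proof.
move=> cf cg; apply: continuous_big; first exact: add_continuous.
move=> i _ x; apply: cvgM.
  exact: (continuous_comp (cf x) (@coord_continuous _ _ _ _ _ _)).
exact: (continuous_comp (cg x) (@coord_continuous _ _ _ _ _ _)).
Qed.

Lemma compact_coord_bounded (A : set 'rV[R]_d) : compact A ->
  exists2 B : R, 0 < B & forall u, A u -> forall i, `|u ord0 i| <= B.
Proof.
move=> /compact_bounded bA.
have [B B0 /= AB] := ex_strict_bound_gt0 bA.
exists B => // u Au i; rewrite (le_trans _ (ltW (AB u Au)))//.
rewrite [leRHS]/Num.norm /= mx_normrE.
by apply/bigmax_geP; right; exists (ord0, i).
Qed.

(** Reduces directional derivatives to derivatives in one real variable, where the chain rule and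
    differentiation under the integral sign are available. *)
Lemma is_derive_lineP (f : 'rV[R]_d -> R) x v l :
  is_derive x v f l <->
  is_derive (0 : R) (1 : R) (fun h : R => f (h *: v + x)) l.
Proof.
have E : (fun h : R => h^-1 *: ((f \o shift x) (h *: v) - f x)) =
  (fun h : R => h^-1 *: (((fun h0 : R => f (h0 *: v + x)) \o shift 0)
      (h *: (1 : R)) - f ((0 : R) *: v + x))).
  apply/funext => h /=; rewrite addr0 scale0r add0r.
  by rewrite -[h *: 1]/(h * 1) mulr1.
by split=> -[dh Dh]; split;
  rewrite /derivable /derive ?E // -E.
Qed.

End dot_product.

(** * Integrals against a compactly supported density *)

(** Integrability is carried along because additivity of the integral needs it at each step of the
    induction. *)
Lemma RintegralZ_sum (dsp : measure_display) (T : measurableType dsp)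
    (R : realType) (mu : {measure set T -> \bar R}) (J : Type) (r : seq J)
    (a : J -> R) (F : J -> T -> R) :
  (forall j, mu.-integrable setT (EFin \o F j)) ->
  mu.-integrable setT (EFin \o (fun x => \sum_(j <- r) a j * F j x)) /\
  \int[mu]_x (\sum_(j <- r) a j * F j x) = \sum_(j <- r) a j * \int[mu]_x F j x.
Proof.
move=> iF; elim: r => [|j r [iS IH]].
  split; first by under eq_fun do rewrite big_nil; exact: integrable0.
  by under eq_Rintegral do rewrite big_nil; rewrite Rintegral_cst// mul0r big_nil.
have iZ : mu.-integrable setT (EFin \o (fun x => a j * F j x)).
  exact: (integrableZl measurableT (a j) (iF j)).
split; first by under eq_fun do rewrite big_cons; exact: (integrableD measurableT iZ iS).
under eq_Rintegral do rewrite big_cons.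
by rewrite RintegralD// RintegralZl// IH big_cons.
Qed.

(** * The Gaussian kernel *)

Section kernel.
Context {R : realType} {d : nat}.
Implicit Types (x z u v : 'rV[R]_d) (s : R).

Lemma lam_gt0 s : 0 < lam s. Proof. exact: expR_gt0. Qed.

Lemma lam_lt1 s : 0 < s -> lam s < 1.
Proof. by move=> s0; rewrite /lam expR_lt1 oppr_lt0. Qed.

Lemma sig_sqr s : 0 < s -> sig s ^+ 2 = 1 - lam s ^+ 2.
Proof.
move=> s0; rewrite /sig sqr_sqrtr// subr_ge0 expr_le1// ltW//;
  [exact: lam_lt1|exact: lam_gt0].
Qed.

Lemma sig_sqr_gt0 s : 0 < s -> 0 < sig s ^+ 2.
Proof.
move=> s0; rewrite sig_sqr// subr_gt0 expr_lt1// ?lam_lt1// ltW//.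
exact: lam_gt0.
Qed.

Lemma sig_gt0 s : 0 < s -> 0 < sig s.
Proof.
move=> s0; rewrite lt_neqAle sqrtr_ge0 andbT eq_sym.
by apply/eqP => s00; have := sig_sqr_gt0 s0; rewrite s00 expr0n ltxx.
Qed.

Definition gauss_const s : R := (Num.sqrt (2 * pi) * sig s) ^- d.

Lemma gauss_const_gt0 s : 0 < s -> 0 < gauss_const s.
Proof.
move=> s0; rewrite invr_gt0 exprn_gt0// mulr_gt0// ?sig_gt0//.
by rewrite sqrtr_gt0 mulr_gt0// pi_gt0.
Qed.

Lemma gauss_kernelE s z : gauss_kernel s z =
  gauss_const s * expR (- (dot z z / (2 * sig s ^+ 2))).
Proof. by rewrite /gauss_kernel enorm_sqr. Qed.

Lemma gauss_kernel_gt0 s z : 0 < s -> 0 < gauss_kernel s z.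
Proof. by move=> s0; rewrite gauss_kernelE mulr_gt0 ?gauss_const_gt0 ?expR_gt0. Qed.

Lemma gauss_kernel_le s z : 0 < s -> gauss_kernel s z <= gauss_const s.
Proof.
move=> s0; rewrite gauss_kernelE ler_piMr ?(ltW (gauss_const_gt0 s0))//.
by rewrite expR_le1 oppr_le0 divr_ge0 ?dot_ge0// mulr_ge0// sqr_ge0.
Qed.

Lemma measurable_dot (f g : 'rV[R]_d -> 'rV[R]_d) :
  (forall i, measurable_fun setT (fun u => f u ord0 i : R)) ->
  (forall i, measurable_fun setT (fun u => g u ord0 i : R)) ->
  measurable_fun setT (fun u => dot (f u) (g u)).
Proof. by move=> mf mg; apply: measurable_sum => i; exact: measurable_funM. Qed.

Lemma measurable_affine_coord x (a : R) i :
  measurable_fun setT (fun u : 'rV[R]_d => (x - a *: u) ord0 i : R).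
Proof.
under eq_fun do rewrite !mxE.
apply: measurable_funB => //; apply: measurable_funM => //.
exact: measurable_coord.
Qed.

Lemma measurable_gauss_kernel s x (a : R) :
  measurable_fun setT (fun u : 'rV[R]_d => gauss_kernel s (x - a *: u)).
Proof.
under eq_fun do rewrite gauss_kernelE.
apply: measurable_funM => //; apply: measurableT_comp => //.
apply: measurableT_comp => //; apply: measurable_funM => //.
by apply: measurable_dot => i; exact: measurable_affine_coord.
Qed.

End kernel.

(** * Noised densities and their first moments *)

Section noised_density.
Context {R : realType} {d : nat}.
Implicit Types (x z u v : 'rV[R]_d) (s : R).
Variables (p : 'rV[R]_d -> R) (K : set 'rV[R]_d).
Hypotheses (p_density : prob_density p) (K_compact : compact K)
  (p_supp : forall x, ~ K x -> p x = 0).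
Local Notation mu := (lebesgue_rV d).

Let mp : measurable_fun setT p. Proof. by case: p_density. Qed.
Let p_ge0 u : 0 <= p u. Proof. by case: p_density. Qed.

Lemma integrable_density : mu.-integrable setT (EFin \o p).
Proof.
case: p_density => _ _ p1; apply/integrableP; split; first exact/measurable_EFinP.
under eq_integral do rewrite gee0_abs ?lee_fin//.
by rewrite p1 ltry.
Qed.

(** Domination by [C * p]: off [K] both sides vanish, so a bound on [K] suffices. *)
Lemma integrable_densityM (f : 'rV[R]_d -> R) (C : R) :
  measurable_fun setT f -> (forall u, K u -> `|f u| <= C) ->
  mu.-integrable setT (EFin \o (fun u => p u * f u)).
Proof.
move=> mf fC.
apply: (@le_integrable _ _ _ mu setT _ _ (fun u => C%:E * (p u)%:E)%E) => //.
- by apply/measurable_EFinP; exact: measurable_funM.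
- move=> u _ /=; rewrite lee_fin normrM (ger0_norm (p_ge0 u)) normrM.
  rewrite (ger0_norm (p_ge0 u)) mulrC.
  have [Ku|/p_supp ->] := pselect (K u); last by rewrite !mulr0.
  by rewrite ler_wpM2r// (le_trans (fC u Ku))// ler_norm.
- exact: (integrableZl measurableT C integrable_density).
Qed.

Lemma Rintegral_density : \int[mu]_u p u = 1.
Proof. by case: p_density => _ _ p1; rewrite /Rintegral p1. Qed.

(* The unnormalised posterior mean of the clean sample given the noised one. *)
Definition moment s x : 'rV[R]_d :=
  \row_i \int[mu]_u (p u * (gauss_kernel s (x - lam s *: u) * u ord0 i)).

Local Notation k s x u := (gauss_kernel s (x - lam s *: u)).

Lemma integrable_noised s x : 0 < s ->
  mu.-integrable setT (EFin \o (fun u => p u * k s x u)).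
Proof.
move=> s0; apply: (@integrable_densityM _ (@gauss_const R d s)).
  exact: measurable_gauss_kernel.
by move=> u _; rewrite ger0_norm ?gauss_kernel_le// ltW ?gauss_kernel_gt0.
Qed.

Lemma integrable_moment s x i : 0 < s ->
  mu.-integrable setT (EFin \o (fun u => p u * (k s x u * u ord0 i))).
Proof.
move=> s0; have [B B0 KB] := compact_coord_bounded K_compact.
apply: (@integrable_densityM _ (@gauss_const R d s * B)).
  apply: measurable_funM; first exact: measurable_gauss_kernel.
  exact: measurable_coord.
move=> u Ku; rewrite normrM ler_pM//; last exact: KB.
by rewrite ger0_norm ?gauss_kernel_le// ltW ?gauss_kernel_gt0.
Qed.

(** The pointwise inequality is integrated against [p], whose mass is one, so [c] survives
    unchanged. With [c = 0] this places posterior means in convex supports; with [c] exponentially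
    small it gives the repulsion estimate. *)
Lemma moment_ge s x (a c : R) v : 0 < s ->
  (forall u, K u -> a * k s x u - c <= dot v u * k s x u) ->
  a * noised p s x - c <= dot v (moment s x).
Proof.
move=> s0 ac; rewrite /dot /moment; under eq_bigr do rewrite mxE.
have [iS <-] := @RintegralZ_sum _ _ R mu _ (index_enum 'I_d)
  (fun i => v ord0 i) (fun i u => p u * (k s x u * u ord0 i))
  (fun i => integrable_moment x i s0).
rewrite -[X in _ - X]mulr1 -Rintegral_density /noised.
have iN := integrable_noised x s0.
have iaN : mu.-integrable setT (EFin \o (fun u => a * (p u * k s x u))).
  exact: (integrableZl measurableT a iN).
have icp : mu.-integrable setT (EFin \o (fun u => c * p u)).
  exact: (integrableZl measurableT c integrable_density).
rewrite -RintegralZl// -RintegralZl//; last exact: integrable_density.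
rewrite -RintegralB//; apply: le_Rintegral => //.
  exact: (integrableB measurableT iaN icp).
move=> u _; rewrite [leRHS](_ : _ = p u * (dot v u * k s x u)); last first.
  by rewrite /dot mulr_suml mulr_sumr; apply: eq_bigr => i _ /=; ring.
rewrite [leLHS](_ : _ = p u * (a * k s x u - c)); last by ring.
have [Ku|/p_supp ->] := pselect (K u); last by rewrite !mul0r.
by rewrite ler_wpM2l// ac.
Qed.

Lemma noised_ge s x (c : R) : 0 < s ->
  (forall u, K u -> c <= k s x u) -> c <= noised p s x.
Proof.
move=> s0 ck; rewrite -[leLHS]mulr1 -Rintegral_density /noised.
rewrite -RintegralZl//; last exact: integrable_density.
apply: le_Rintegral => //.
- exact: (integrableZl measurableT c integrable_density).
- exact: integrable_noised.
move=> u _; rewrite mulrC.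
have [Ku|/p_supp ->] := pselect (K u); last by rewrite !mul0r.
by rewrite ler_wpM2l// ck.
Qed.

(** Since [K] is bounded, the kernel has a positive lower bound on it. *)
Lemma noised_gt0 s x : 0 < s -> 0 < noised p s x.
Proof.
move=> s0; have [B B0 KB] := compact_coord_bounded K_compact.
pose C := \sum_(i < d) (`|x ord0 i| + lam s * B) ^+ 2.
apply: (@lt_le_trans _ _
  (gauss_const s (d := d) * expR (- (C / (2 * sig s ^+ 2))))).
  by rewrite mulr_gt0 ?gauss_const_gt0 ?expR_gt0.
apply: noised_ge => // u Ku; rewrite gauss_kernelE.
rewrite ler_pM2l ?gauss_const_gt0// ler_expR lerN2.
apply: ler_wpM2r; first by rewrite invr_ge0 mulr_ge0// ltW// sig_sqr_gt0.
rewrite /dot /C; apply: ler_sum => i _; rewrite !mxE -expr2 -[leLHS]real_normK ?num_real//.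
rewrite lerXn2r ?nnegrE ?addr_ge0 ?mulr_ge0 ?(ltW (lam_gt0 _)) ?(ltW B0)//.
rewrite (le_trans (ler_normB _ _))// lerD2l normrM gtr0_norm ?lam_gt0//.
by rewrite ler_wpM2l ?(ltW (lam_gt0 _))// KB.
Qed.

End noised_density.

(** * Scores as posterior means *)

Lemma is_derive_expR_quadratic (R : realType) (c a0 a1 a2 h : R) :
  is_derive h (1 : R) (fun t : R => c * expR (a0 + a1 * t + a2 * t ^+ 2))
    (c * expR (a0 + a1 * h + a2 * h ^+ 2) * (a1 + 2 * a2 * h)).
Proof.
pose q := cst a0 + a1 \*: (id : R -> R) + a2 \*: ((id : R -> R) ^+ 2).
have -> : (fun t : R => c * expR (a0 + a1 * t + a2 * t ^+ 2)) = c \*: (expR \o q).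
  by [].
have -> : expR (a0 + a1 * h + a2 * h ^+ 2) = expR (q h) by [].
have dq : is_derive h (1 : R) q (a1 + 2 * a2 * h).
  apply: is_derive_eq.
  rewrite /GRing.scale /=; ring.
apply: is_derive_eq.
rewrite /GRing.scale /=; ring.
Qed.

Section score.
Context {R : realType} {d : nat}.
Implicit Types (x z u v : 'rV[R]_d) (s : R).
Variables (p : 'rV[R]_d -> R) (K : set 'rV[R]_d).
Hypotheses (p_density : prob_density p) (K_compact : compact K)
  (p_supp : forall x, ~ K x -> p x = 0).
Local Notation mu := (lebesgue_rV d).

Lemma gauss_kernel_line s i (h : R) z :
  gauss_kernel s (h *: delta_mx ord0 i + z) =
  gauss_const s (d := d) * expR (- ((dot z z + 2 * h * z ord0 i + h ^+ 2)
                         / (2 * sig s ^+ 2))).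
Proof.
have e1 v : dot (delta_mx ord0 i) v = v ord0 i.
  rewrite /dot (bigD1 i)//= mxE !eqxx mul1r big1 ?addr0// => j ji.
  by rewrite mxE (negbTE ji) andbF mul0r.
have -> : dot z z + 2 * h * z ord0 i + h ^+ 2 =
    dot (h *: delta_mx ord0 i + z) (h *: delta_mx ord0 i + z).
  by rewrite !(dotDl, dotDr, dotZl, dotZr) !e1 (dotC z) e1 mxE !eqxx /=; ring.
exact: gauss_kernelE.
Qed.

Lemma is_derive_gauss_kernel_line s i (h : R) z : 0 < s ->
  is_derive h (1 : R) (fun h0 : R => gauss_kernel s (h0 *: delta_mx ord0 i + z))
    (gauss_kernel s (h *: delta_mx ord0 i + z) *
       (- (z ord0 i + h) / sig s ^+ 2)).
Proof.
move=> s0.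
have ss : sig s != 0 by rewrite gt_eqF// sig_gt0.
pose a0 := - (dot z z / (2 * sig s ^+ 2)).
pose a1 := - (z ord0 i / sig s ^+ 2).
pose a2 := - (2 * sig s ^+ 2)^-1.
have E (t : R) : gauss_kernel s (t *: delta_mx ord0 i + z) =
    gauss_const s (d := d) * expR (a0 + a1 * t + a2 * t ^+ 2).
  rewrite gauss_kernel_line; congr (_ * expR _).
  by rewrite /a0 /a1 /a2; field.
have -> : (fun t : R => gauss_kernel s (t *: delta_mx ord0 i + z)) =
    (fun t => gauss_const s (d := d) * expR (a0 + a1 * t + a2 * t ^+ 2)).
  exact/funext/E.
rewrite E (_ : - _ / _ = a1 + 2 * a2 * h); first exact: is_derive_expR_quadratic.
by rewrite /a1 /a2; field.
Qed.

(** Tweedie's formula before normalisation, by differentiation under the integral along a coordinate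
    line. *)
Lemma is_derive_noised s x i : 0 < s ->
  is_derive x (delta_mx ord0 i) (noised p s)
    ((lam s * moment p s x ord0 i - x ord0 i * noised p s x) / sig s ^+ 2).
Proof.
move=> s0; apply/is_derive_lineP.
have [B B0 KB] := compact_coord_bounded K_compact.
have ss := sig_sqr_gt0 s0.
pose f (h : R) u := p u * gauss_kernel s (h *: delta_mx ord0 i + x - lam s *: u).
pose g (h : R) u := p u * (gauss_kernel s (h *: delta_mx ord0 i + x - lam s *: u)
   * (- ((x - lam s *: u) ord0 i + h) / sig s ^+ 2)).
have df h u : is_derive h (1 : R) (f ^~ u) (g h u).
  rewrite /f /g.
  under eq_fun do rewrite -addrA.
  rewrite -addrA.
  have := is_derive_gauss_kernel_line i h (x - lam s *: u) s0.
  by move/(is_deriveZ (p u)).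
have d1f h u : partial1of2 f h u = g h u.
  by rewrite partial1of2E; have [_ ->] := df h u.
(* Dominating constant: the peak of the kernel times a bound on the linear factor for [u] in [K],
   the summand [1] accounting for [|h| < 1]. *)
pose C := gauss_const s (d := d) * ((`|x ord0 i| + lam s * B + 1) / sig s ^+ 2).
pose G u := p u * C.
have p0 u : 0 <= p u by case: p_density.
have bnd u : K u -> `|(x - lam s *: u) ord0 i| <= `|x ord0 i| + lam s * B.
  move=> Ku; rewrite !mxE (le_trans (ler_normB _ _))// lerD2l normrM.
  by rewrite gtr0_norm ?lam_gt0// ler_wpM2l ?(ltW (lam_gt0 _))// KB.
have C0 : 0 <= C.
  rewrite mulr_ge0 ?(ltW (gauss_const_gt0 s0))// divr_ge0 ?(ltW ss)//.
  by rewrite !addr_ge0// mulr_ge0 ?(ltW (lam_gt0 _)) ?(ltW B0).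
have I0 : `](-1 : R), 1[%classic (0 : R) by rewrite /= in_itv/= ltrN10 ltr01.
have intf h : `](-1 : R), 1[%classic h -> mu.-integrable setT (EFin \o f h).
  by move=> _; exact: (integrable_noised p_density p_supp).
have derf h u : `](-1 : R), 1[%classic h -> [set: 'rV[R]_d] u ->
    derivable (f ^~ u) h 1.
  by move=> _ _; have [] := df h u.
have G0 u : 0 <= G u by rewrite mulr_ge0.
have iG : mu.-integrable setT (EFin \o G).
  by apply: (integrable_densityM p_density p_supp (C := `|C|)).
have Gub h u : `](-1 : R), 1[%classic h -> [set: 'rV[R]_d] u ->
    `|partial1of2 f h u| <= G u.
  rewrite /= in_itv/= => /andP[h1 h2] _; rewrite d1f /g /G normrM ger0_norm//.
  have [Ku|/p_supp ->] := pselect (K u); last by rewrite !mul0r.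
  rewrite ler_wpM2l// normrM ler_pM//.
    by rewrite gtr0_norm ?gauss_kernel_gt0// gauss_kernel_le.
  rewrite normrM normrN [X in _ * X <= _]gtr0_norm ?invr_gt0//.
  rewrite ler_pM2r ?invr_gt0// (le_trans (ler_normD _ _))// lerD ?bnd//.
  by rewrite ltW// ltr_norml h1 h2.
have D1 := derivable_under_integral measurableT I0 intf derf G0 iG Gub.
have D2 := differentiation_under_integral measurableT I0 intf derf G0 iG Gub.
split; first exact: D1.
rewrite -derive1E D2.
have iM := integrable_moment p_density K_compact p_supp x i s0.
have iN := integrable_noised p_density p_supp x s0.
transitivity (\int[mu]_u (lam s / sig s ^+ 2 *
    (p u * (gauss_kernel s (x - lam s *: u) * u ord0 i)) -
    x ord0 i / sig s ^+ 2 * (p u * gauss_kernel s (x - lam s *: u)))).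
  apply: eq_Rintegral => u _; rewrite d1f /g scale0r add0r addr0 !mxE; ring.
rewrite RintegralB//; last 2 first.
- exact: (integrableZl measurableT _ iM).
- exact: (integrableZl measurableT _ iN).
by rewrite !RintegralZl// mxE /noised; ring.
Qed.

End score.

Lemma is_derive_ln (R : realType) (d : nat) (f : 'rV[R]_d -> R) x v l :
  0 < f x -> is_derive x v f l -> is_derive x v (fun x => ln (f x)) (l / f x).
Proof.
move=> fx /is_derive_lineP df; apply/is_derive_lineP.
have := @is_derive1_comp _ (@ln R) (fun h : R => f (h *: v + x)) 0 (f x)^-1 l.
rewrite scale0r add0r mulrC; apply => //; exact: is_derive1_ln.
Qed.

Lemma is_derive_sumZ (R : realType) (d : nat) (J : Type) (r : seq J)
    (a : J -> R) (f : J -> 'rV[R]_d -> R) (df : J -> R) x v :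
  (forall j, is_derive x v (f j) (df j)) ->
  is_derive x v (fun x => \sum_(j <- r) a j * f j x) (\sum_(j <- r) a j * df j).
Proof.
move=> h; elim: r => [|j r IH].
  by under eq_fun do rewrite big_nil; rewrite big_nil; exact: is_derive_cst.
under eq_fun do rewrite big_cons.
by rewrite big_cons; apply: is_deriveD; exact: is_deriveZ.
Qed.

(** * Scores of the mixture and the guided Euler step *)

Section guided_step.
Context {R : realType} {d : nat} {I : finType} (w : I -> R)
  (p : I -> 'rV[R]_d -> R) (K : I -> set 'rV[R]_d) (eta0 : I).
Hypotheses (w_ge0 : forall eta, 0 <= w eta) (w_eta0_gt0 : 0 < w eta0)
  (p_density : forall eta, prob_density (p eta))
  (p_supp : forall eta x, ~ K eta x -> p eta x = 0)
  (K_compact : forall eta, compact (K eta)).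
Implicit Types (x y : 'rV[R]_d) (s : R).

Let N_gt0 eta s x : 0 < s -> 0 < noised (p eta) s x.
Proof. by apply: (noised_gt0 (K := K eta)) => // ?; exact: p_supp. Qed.

Let dN eta s x i : 0 < s ->
  is_derive x (delta_mx ord0 i) (noised (p eta) s)
    ((lam s * moment (p eta) s x ord0 i - x ord0 i * noised (p eta) s x)
     / sig s ^+ 2).
Proof. by apply: (is_derive_noised (K := K eta)) => // ?; exact: p_supp. Qed.

Lemma mixture_gt0 s x : 0 < s -> 0 < mixture w p s x.
Proof.
move=> s0; rewrite /mixture (bigD1 eta0)//= ltr_wpDr ?mulr_gt0 ?N_gt0//.
by apply: sumr_ge0 => eta _; rewrite mulr_ge0// ltW// N_gt0.
Qed.

Definition post_mean s x : 'rV[R]_d :=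
  (noised (p eta0) s x)^-1 *: moment (p eta0) s x.

Definition mixture_mean s x : 'rV[R]_d :=
  (mixture w p s x)^-1 *: \sum_eta w eta *: moment (p eta) s x.

(** Tweedie's formula: the derivatives of the components add up, and division by the mixture density
    turns moments into the posterior mean. *)
Lemma grad_ln_mixture s x : 0 < s ->
  grad (fun x => ln (mixture w p s x)) x =
  (sig s ^+ 2)^-1 *: (lam s *: mixture_mean s x - x).
Proof.
move=> s0; apply/rowP => i; rewrite !mxE.
have m0 := mixture_gt0 x s0.
have dm := is_derive_sumZ (index_enum I) w (fun eta => dN eta x i s0).
have [_ ->] := is_derive_ln m0 dm.
rewrite summxE.
have S0 : sig s != 0 by rewrite gt_eqF// sig_gt0.
have M0 : mixture w p s x != 0 by rewrite gt_eqF.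
transitivity ((lam s * (\sum_eta (w eta *: moment (p eta) s x) ord0 i)
      - x ord0 i * mixture w p s x) / sig s ^+ 2 / mixture w p s x); last first.
  by field; rewrite S0 M0.
congr (_ / _).
rewrite [in RHS]/mixture !mulr_sumr -sumrB mulr_suml; apply: eq_bigr => eta _.
have -> : (w eta *: moment (p eta) s x) ord0 i = w eta * moment (p eta) s x ord0 i.
  by rewrite [LHS]mxE.
by field.
Qed.

(** The log posterior is a difference of two log densities, whose common score term
    [- x / sig s ^+ 2] cancels. *)
Lemma grad_ln_posterior s x : 0 < s ->
  grad (fun x => ln (posterior w p eta0 s x)) x =
  (lam s / sig s ^+ 2) *: (post_mean s x - mixture_mean s x).
Proof.
move=> s0.
have -> : (fun x => ln (posterior w p eta0 s x)) =
    (fun x => ln (w eta0 * noised (p eta0) s x)) - (fun x => ln (mixture w p s x)).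
  apply/funext => z; rewrite /posterior ln_div// posrE ?mixture_gt0//.
  by rewrite mulr_gt0// N_gt0.
apply/rowP => i; rewrite mxE.
have wN0 : 0 < w eta0 * noised (p eta0) s x by rewrite mulr_gt0// N_gt0.
have dm := is_derive_sumZ (index_enum I) w (fun eta => dN eta x i s0).
have d1 : is_derive x (delta_mx ord0 i) (fun x => ln (w eta0 * noised (p eta0) s x))
    (w eta0 * ((lam s * moment (p eta0) s x ord0 i
      - x ord0 i * noised (p eta0) s x) / sig s ^+ 2) /
     (w eta0 * noised (p eta0) s x)).
  exact: (is_derive_ln wN0 (is_deriveZ (w eta0) (dN eta0 x i s0))).
have d2 := is_derive_ln (mixture_gt0 x s0) dm.
have [_ ->] := is_deriveB d1 d2.
have [_ D2] := d2.
have := congr1 (fun v : 'rV[R]_d => v ord0 i) (grad_ln_mixture x s0).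
rewrite /grad mxE D2 => ->; rewrite /post_mean.
move: (mixture_mean s x) (moment (p eta0) s x) => m M; rewrite !mxE.
have S0 : sig s != 0 by rewrite gt_eqF// sig_gt0.
have N0 : noised (p eta0) s x != 0 by rewrite gt_eqF ?N_gt0.
have W0 : w eta0 != 0 by rewrite gt_eqF.
have -> : (0 : 'I_1) = ord0 by exact/val_inj.
by field; rewrite S0 N0 W0.
Qed.

(* In the variable [expR s *: x], an Euler step is an exact affine
   interpolation of the current point with the extrapolated posterior mean. *)
Lemma guided_step s (D gamma : R) x : 0 < s ->
  let b := (1 - expR (- D)) / sig s ^+ 2 in
  expR (s - D) *: (expR D *: x + (expR D - 1) *:
     (grad (fun x => ln (mixture w p s x)) x +
      gamma *: grad (fun x => ln (posterior w p eta0 s x)) x)) =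
  (1 - b) *: (expR s *: x) + b *: (post_mean s x +
    (gamma - 1) *: (post_mean s x - mixture_mean s x)).
Proof.
move=> s0 b; rewrite grad_ln_mixture// grad_ln_posterior//.
move: (post_mean s x) (mixture_mean s x) => m0 m.
apply/rowP => i; rewrite !mxE.
have S0 : sig s ^+ 2 != 0 by rewrite gt_eqF// sig_sqr_gt0.
have eL : lam s != 0 by rewrite gt_eqF// lam_gt0.
have eD : expR D != 0 by rewrite gt_eqF// expR_gt0.
rewrite /b expRD expRN.
have -> : expR s = (lam s)^-1 by rewrite /lam expRN invrK.
move: S0; rewrite sig_sqr// => S0.
by field; rewrite S0 eL eD.
Qed.

End guided_step.

(** * Projections onto compact convex sets *)

Section geometry.
Context {R : realType} {d : nat}.
Implicit Types (x y u v P : 'rV[R]_d) (A : set 'rV[R]_d).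

Lemma convex_set_combination A u v (a : R) : convex_set A -> A u -> A v ->
  0 <= a -> a <= 1 -> A (a *: u + (1 - a) *: v).
Proof.
move=> cA Au Av a0 a1.
by have := cA u v (Itv01 a0 a1); rewrite !inE; apply.
Qed.

(** Minimality serves to compare distances after a step; the obtuse angle condition serves to
    compare [P] with the posterior mean. *)
Definition is_projection A y P :=
  [/\ A P, forall u, A u -> dot (y - P) (y - P) <= dot (y - u) (y - u) &
      forall u, A u -> dot (y - P) (u - P) <= 0].

(** A minimiser exists by compactness. Moving it a fraction [a] towards [u] cannot decrease the
    distance, which gives [2 * g <= a * n] for every [a] in (0, 1] and excludes [g > 0]. *)
Lemma projection_exists A y : A !=set0 -> compact A -> convex_set A ->
  exists P, is_projection A y P.
Proof.
move=> A0 cA vA.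
have cf : continuous (fun u : 'rV[R]_d => dot (y - u) (y - u)).
  have cs : continuous (fun u : 'rV[R]_d => y - u).
    by move=> u; apply: continuousB => //; exact: cst_continuous.
  exact: (continuous_dot cs cs).
have [P] := compact_EVT_min A0 cA (continuous_subspaceT cf).
rewrite inE => AP Pmin; exists P.
have Pm u : A u -> dot (y - P) (y - P) <= dot (y - u) (y - u).
  by move=> Au; apply: Pmin; rewrite inE.
split=> // u Au; rewrite leNgt; apply/negP => g0.
set g := dot (y - P) (u - P) in g0; pose n := dot (u - P) (u - P).
have key (a : R) : 0 < a -> a <= 1 -> 2 * g <= a * n.
  move=> a0 a1; have := Pm _ (convex_set_combination vA Au AP (ltW a0) a1).
  have -> : y - (a *: u + (1 - a) *: P) = (y - P) - a *: (u - P).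
    by apply/rowP => i; rewrite !mxE; ring.
  rewrite [leRHS](_ : _ = dot (y - P) (y - P) - 2 * a * g + a * (a * n)).
    by move=> h; rewrite -(ler_pM2l a0); lra.
  rewrite /g /n; move: (y - P) (u - P) => v z.
  by rewrite !(dotBl, dotBr, dotZl, dotZr) (dotC z v); ring.
have n2 : 2 * g <= n by rewrite -[leRHS]mul1r key.
have n0 : 0 < n by lra.
(* The choice [a = g / n], at most 1 by [n2], yields [2 * g <= g]. *)
have : 2 * g <= g / n * n by apply: key; rewrite ?divr_gt0// ler_pdivrMr//; lra.
by rewrite divfK ?gt_eqF//; lra.
Qed.

(** The squared distance attains its minimum on the compact product, and a zero minimum would be a
    common point. *)
Lemma compact_gap A1 A2 : compact A1 -> compact A2 -> A1 `&` A2 = set0 ->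
  exists2 g : R, 0 < g & forall u v, A1 u -> A2 v -> g <= dot (u - v) (u - v).
Proof.
move=> c1 c2 A12.
have [[[u0 v0] [A1u0 A2v0]]|no] := pselect ((A1 `*` A2) !=set0); last first.
  by exists 1 => // u v A1u A2v; exfalso; apply: no; exists (u, v).
have cf : continuous (fun z : 'rV[R]_d * 'rV[R]_d => dot (z.1 - z.2) (z.1 - z.2)).
  have cs : continuous (fun z : 'rV[R]_d * 'rV[R]_d => z.1 - z.2).
    by move=> z; apply: continuousB; [exact: cvg_fst|exact: cvg_snd].
  exact: (continuous_dot cs cs).
have [|[P Q]] := compact_EVT_min _ (compact_setX c1 c2) (continuous_subspaceT cf).
  by exists (u0, v0).
rewrite inE => -[/= A1P A2Q] PQmin.
exists (dot (P - Q) (P - Q)) => [|u v A1u A2v]; last first.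
  by apply: (PQmin (u, v)); rewrite inE.
rewrite lt_neqAle dot_ge0 andbT; apply/eqP => /esym/dot_eq0/subr0_eq PQ.
have : (A1 `&` A2) P by split=> //; rewrite PQ.
by rewrite A12.
Qed.

(** The witness is the minimum of the individual constants, capped at 1 so that an empty index type
    is covered. *)
Lemma finite_uniform_gt0 (J : finType) (Q : J -> R -> Prop) :
  (forall j a b, Q j a -> 0 < b -> b <= a -> Q j b) ->
  (forall j, exists2 a, 0 < a & Q j a) ->
  exists2 a, 0 < a & forall j, Q j a.
Proof.
move=> Qle Qex.
have /choice[f fP] : forall j, exists a, 0 < a /\ Q j a.
  by move=> j; have [a a0 Qa] := Qex j; exists a.
exists (\big[Order.min/1]_j f j).
  by apply/bigmin_gtP; split=> // j _; have [] := fP j.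
move=> j; apply: (Qle j (f j)); first by have [] := fP j.
  by apply/bigmin_gtP; split=> // i _; have [] := fP i.
exact: bigmin_le_cond.
Qed.

(** Let [Q] be the projection of the mean [m] on [A]. Averaging the obtuse angle inequality at [Q]
    over the posterior gives [|m - Q|^2 <= 0]. *)
Lemma post_mean_in (p : 'rV[R]_d -> R) A s x : prob_density p ->
  A !=set0 -> compact A -> convex_set A -> (forall x, ~ A x -> p x = 0) ->
  0 < s -> A ((noised p s x)^-1 *: moment p s x).
Proof.
move=> dp A0 cA vA pA s0; set m := _ *: _.
have [Q [AQ _ Qv]] := projection_exists m A0 cA vA.
suff /dot_eq0/subr0_eq -> : dot (m - Q) (m - Q) = 0 by [].
have N0 := noised_gt0 dp cA pA x s0.
have Mm : moment p s x = noised p s x *: m.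
  by rewrite scalerA divff ?scale1r// gt_eqF.
have : dot (Q - m) Q * noised p s x - 0 <= dot (Q - m) (moment p s x).
  apply: (moment_ge dp cA pA) => // u Au; rewrite subr0.
  rewrite ler_pM2r ?gauss_kernel_gt0// -subr_ge0 -dotBr -opprB -scaleN1r dotZl.
  by rewrite mulN1r oppr_ge0 Qv.
rewrite subr0 Mm dotZr mulrC ler_pM2l// -subr_ge0 -dotBr -opprB -scaleN1r dotZl.
by rewrite mulN1r oppr_ge0 => h; apply/eqP; rewrite eq_le h dot_ge0.
Qed.

End geometry.

(** * Lower bounds for the noised density *)

Section lower_bound.
Context {R : realType} {d : nat}.
Implicit Types (x y u v P : 'rV[R]_d) (A : set 'rV[R]_d) (s : R).

Lemma lebesgue_rV_cube (c : 'rV[R]_d) (r : R) : 0 <= r ->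
  measurable [set u : 'rV[R]_d | forall i, u ord0 i \in `[c ord0 i - r, c ord0 i + r]] /\
  lebesgue_rV d [set u : 'rV[R]_d | forall i,
    u ord0 i \in `[c ord0 i - r, c ord0 i + r]] = ((2 * r) ^+ d)%:E.
Proof.
move=> r0; split.
  rewrite (_ : [set u | _] = \bigcap_(i in [set: 'I_d])
    ((fun u : 'rV[R]_d => u ord0 i : measurableTypeR R) @^-1`
      `[c ord0 i - r, c ord0 i + r])).
    apply: fin_bigcap_measurable => // i _.
    by rewrite -[X in measurable X]setTI; exact: measurable_coord.
  by apply/seteqP; split => u /= Bu i; [move=> _|]; exact: Bu.
have := @lebesgue_rV_box R d (fun i => `[c ord0 i - r, c ord0 i + r]%classic).
move=> -> //.
rewrite (eq_bigr (fun=> (2 * r)%:E)); last first.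
  move=> i _; rewrite lebesgue_measure_itv/= lte_fin.
  case: ltP => h; last by congr EFin; lra.
  by rewrite -EFinB; congr EFin; lra.
elim: d => [|n IH]; first by rewrite big_ord0.
by rewrite big_ord_recl IH exprS.
Qed.

(* A copy of a cube of [A] contracted towards [P] lies in [A] by convexity. *)
Lemma convex_thick A (Y e : R) : convex_set A -> compact A -> A° !=set0 ->
  0 < e -> exists2 c : R, 0 < c & forall y P, (forall i, `|y ord0 i| <= Y) ->
    A P -> exists B, [/\ measurable B, B `<=` A, lebesgue_rV d B = c%:E &
      forall u, B u -> dot (y - u) (y - u) <= dot (y - P) (y - P) + e].
Proof.
move=> vA cA [x0 /= /nbhs_ballP[r /= r0 rA]] e0.
have [M M0 AM] := compact_coord_bounded cA.
(* Contraction by a ratio [a <= 1] raises the squared distance to [y] by at most [a * C], whence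
   [a = min(1, e / C)]; the final 1 keeps [C] positive. *)
pose C := (\sum_(i < d) ((2 * M) ^+ 2 + 2 * (`|Y| + M) * (2 * M))) + 1.
have C0 : 0 < C.
  rewrite ltr_wpDl// sumr_ge0// => i _.
  by rewrite addr_ge0 ?sqr_ge0// !mulr_ge0 ?addr_ge0// ltW.
pose a := Num.min 1 (e / C).
have a0 : 0 < a by rewrite lt_min ltr01 divr_gt0.
have a1 : a <= 1 by rewrite ge_min lexx.
have aC : a * C <= e by rewrite -ler_pdivlMr// ge_min lexx orbT.
exists ((2 * (a * (r / 2))) ^+ d); first by rewrite exprn_gt0// !mulr_gt0.
move=> y P yY AP; pose c := a *: x0 + (1 - a) *: P.
have ar0 : 0 <= a * (r / 2) by rewrite mulr_ge0 ?divr_ge0 ?ltW.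
have [mB muB] := lebesgue_rV_cube c ar0.
set B := [set u | _] in mB muB; exists B.
(* [u] is the image of [u'] under the homothety of centre [P] and ratio [a]. The half-side
   [a * (r / 2)] keeps [u'] strictly within sup distance [r] of [x0]. *)
have contract u : B u -> exists2 u', A u' & u = a *: u' + (1 - a) *: P.
  move=> Bu; exists (x0 + a^-1 *: (u - c)); last first.
    apply/rowP => i; rewrite !mxE; field; by rewrite gt_eqF.
  apply: rA; split=> // i j; rewrite ord1 !mxE; have := Bu j.
  rewrite in_itv/= !mxE => /andP[b1 b2].
  rewrite /ball/= opprD addNKr normrN normrM gtr0_norm ?invr_gt0//.
  rewrite mulrC ltr_pdivrMr// (@le_lt_trans _ _ (a * (r / 2)))//.
    by rewrite ler_norml; apply/andP; split; lra.
  by rewrite mulrC ltr_pM2r//; lra.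
split=> //.
  by move=> u /contract[u' Au' ->]; apply: convex_set_combination => //; exact: ltW.
move=> u /contract[u' Au' ->]; apply: le_trans (lerD (lexx _) aC).
apply: (@le_trans _ _ (dot (y - P) (y - P) +
    \sum_(i < d) a * ((2 * M) ^+ 2 + 2 * (`|Y| + M) * (2 * M)))); last first.
  by rewrite lerD2l -mulr_sumr ler_pM2l// lerDl.
rewrite /dot -big_split/=; apply: ler_sum => i _; rewrite !mxE.
have := AM _ Au' i; have := AM _ AP i; have := yY i.
move: (y ord0 i) (P ord0 i) (u' ord0 i) => yi Pi ui hy hP hu.
have hy' : `|yi| <= `|Y| by rewrite (le_trans hy)// ler_norm.
have -> : (yi - (a * ui + (1 - a) * Pi)) * (yi - (a * ui + (1 - a) * Pi)) =
   (yi - Pi) * (yi - Pi) + a * (a * (ui - Pi) ^+ 2 + 2 * ((yi - Pi) * (Pi - ui))).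
  by ring.
rewrite lerD2l ler_pM2l//.
have h1 : `|ui - Pi| <= 2 * M.
  by rewrite (le_trans (ler_normB _ _))//; lra.
have h2 : `|yi - Pi| <= `|Y| + M.
  by rewrite (le_trans (ler_normB _ _))// lerD.
apply: lerD.
  rewrite -[leRHS]mul1r ler_pM ?sqr_ge0 ?(ltW a0)//.
  by rewrite -real_normK ?num_real// lerXn2r ?nnegrE// mulr_ge0// ltW.
rewrite -mulrA ler_pM2l// (le_trans (ler_norm _))// normrM ler_pM//.
by rewrite distrC.
Qed.

Lemma noised_ge_mass (p : 'rV[R]_d -> R) A s x (B : set 'rV[R]_d) (c l : R) :
  prob_density p -> (forall x, ~ A x -> p x = 0) -> 0 < s ->
  measurable B -> lebesgue_rV d B = c%:E ->
  (forall u, B u -> l <= p u * gauss_kernel s (x - lam s *: u)) ->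
  l * c <= noised p s x.
Proof.
move=> dp pA s0 mB muB lB.
have iI : (lebesgue_rV d).-integrable setT (EFin \o (\1_B : 'rV[R]_d -> R)).
  apply/integrableP; split; first exact/measurable_EFinP.
  under eq_integral do rewrite gee0_abs ?lee_fin//.
  by rewrite integral_indic// setIT [X in (X < _)%E]muB ltry.
have -> : l * c = \int[lebesgue_rV d]_u (l * \1_B u).
  by rewrite RintegralZl// /Rintegral integral_indic// setIT [X in fine X]muB.
rewrite /noised; apply: le_Rintegral => //.
- exact: (integrableZl measurableT l iI).
- exact: (integrable_noised dp pA x s0).
move=> u _; have [Bu|nBu] := pselect (B u).
  by rewrite indicE mem_set// mulr1 lB.
rewrite indicE memNset// mulr0 mulr_ge0//; first by case: dp.
by rewrite ltW// gauss_kernel_gt0.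
Qed.

End lower_bound.

(** * Repulsion from the other classes *)

Section guidance.
Context {R : realType} {d : nat}.
Implicit Types (x y u v P : 'rV[R]_d) (A : set 'rV[R]_d) (s : R).

(** At [x = lam s *: y] the kernel is a Boltzmann weight in [u] with energy [|y - u|^2] and this
    inverse temperature. *)
Definition inv_temp s : R := lam s ^+ 2 / (2 * sig s ^+ 2).

Lemma gauss_kernel_scaled s y u :
  gauss_kernel s (lam s *: y - lam s *: u) =
  gauss_const s (d := d) * expR (- (inv_temp s * dot (y - u) (y - u))).
Proof.
rewrite gauss_kernelE -scalerBr dotZl dotZr; congr (_ * expR _).
by rewrite /inv_temp expr2; congr (- _); rewrite -!mulrA; congr (_ * (_ * _)); rewrite mulrC.
Qed.

Lemma inv_temp_gt0 s : 0 < s -> 0 < inv_temp s.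
Proof.
by move=> s0; rewrite divr_gt0 ?exprn_gt0 ?lam_gt0// mulr_gt0 ?sig_sqr_gt0.
Qed.

(** The inverse temperature equals [1 / (2 (e^(2s) - 1))], so the bound amounts to
    [e^(2s) <= 1 + 1 / (2C)]. *)
Lemma inv_temp_large (C : R) : 0 < C ->
  exists2 s0 : R, 0 < s0 & forall s, 0 < s -> s < s0 -> C <= inv_temp s.
Proof.
move=> C0; exists (ln (1 + (2 * C)^-1) / 2).
  by rewrite divr_gt0// ln_gt0// ltrDl invr_gt0 mulr_gt0.
move=> s s_gt0 ss0; have ls := lam_gt0 s.
rewrite /inv_temp sig_sqr// ler_pdivlMr; last first.
  by rewrite mulr_gt0// -sig_sqr// sig_sqr_gt0.
have : expR (s *+ 2) < 1 + (2 * C)^-1.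
  rewrite -[ltRHS]lnK ?posrE ?addr_gt0 ?invr_gt0 ?mulr_gt0// ltr_expR.
  by rewrite mulr2n; lra.
have <- : lam s ^- 2 = expR (s *+ 2).
  by rewrite /lam expRN exprVn invrK -mulr_natl expRM_natl.
have l2 : 0 < lam s ^+ 2 by rewrite exprn_gt0.
move: (lam s ^+ 2) l2 => L L0 h.
have : L^-1 * (2 * C * L) < (1 + (2 * C)^-1) * (2 * C * L).
  by rewrite ltr_pM2r// !mulr_gt0.
have -> : L^-1 * (2 * C * L) = 2 * C by field; rewrite gt_eqF.
have -> : (1 + (2 * C)^-1) * (2 * C * L) = 2 * C * L + L.
  by field; rewrite gt_eqF.
lra.
Qed.

(* Points of [A] either see [P] under an acute angle from [y], or are
   exponentially less likely than [P]. *)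
Lemma moment_repelled (p : 'rV[R]_d -> R) A s y P (g e B : R) :
  prob_density p -> compact A -> (forall x, ~ A x -> p x = 0) -> 0 < s ->
  0 <= g -> 0 <= e -> 0 <= B ->
  (forall u, A u -> g <= dot (u - P) (u - P)) ->
  (forall u, A u -> dot (y - u) (y - u) <= B) ->
  ((g - e) / 2 + dot (y - P) P) * noised p s (lam s *: y) -
    B / 2 * (gauss_const s (d := d) *
      expR (- (inv_temp s * (dot (y - P) (y - P) + e)))) <=
  dot (y - P) (moment p s (lam s *: y)).
Proof.
move=> dp cA pA s0 g0 e0 B0 Ag AB; apply: (moment_ge dp cA pA s0) => u Au.
set k := gauss_kernel _ _; set c := _ * expR _.
have k0 : 0 < k by exact: gauss_kernel_gt0.
have c0 : 0 < c by rewrite mulr_gt0 ?gauss_const_gt0 ?expR_gt0.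
(* Polarisation expresses the angle at [P] through the three squared distances. *)
have vE : dot (y - P) u = dot (y - P) P +
    (dot (y - P) (y - P) + dot (u - P) (u - P) - dot (y - u) (y - u)) / 2.
  by rewrite !(dotBl, dotBr) (dotC u y) (dotC P y) (dotC P u); field.
have := Ag _ Au; have := AB _ Au; have := dot_ge0 (y - P).
rewrite vE; move: (dot (u - P) (u - P)) => U.
(* Points nearly as close as [P] satisfy the bound without error. For farther ones the loss is at
   most [B / 2] times a kernel value below [c]. *)
have [le_e|gt_e] := leP (dot (y - u) (y - u)) (dot (y - P) (y - P) + e).
  move: (dot (y - u) (y - u)) (dot (y - P) (y - P)) (dot (y - P) P) le_e => W D a.
  move=> le_e D0 WB gU; have Bc : 0 <= B / 2 * c by rewrite mulr_ge0 ?divr_ge0 ?(ltW c0).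
  apply: (@le_trans _ _ (((g - e) / 2 + a) * k)); first by lra.
  by rewrite ler_pM2r//; lra.
have kc : k <= c.
  rewrite /k gauss_kernel_scaled ler_pM2l ?gauss_const_gt0// ler_expR lerN2.
  by rewrite ler_pM2l ?inv_temp_gt0// ltW.
move: (dot (y - u) (y - u)) (dot (y - P) (y - P)) (dot (y - P) P) gt_e => W D a.
move=> gt_e D0 WB gU.
have Bkc : B / 2 * k <= B / 2 * c by rewrite ler_wpM2l// divr_ge0.
apply: (@le_trans _ _ (((g - e) / 2 + a) * k - B / 2 * k)); first by lra.
by rewrite -mulrBl ler_pM2r//; lra.
Qed.

Context {I : finType} (w : I -> R)
  (p : I -> 'rV[R]_d -> R) (K : I -> set 'rV[R]_d) (eta0 : I).
Hypotheses (w_ge0 : forall eta, 0 <= w eta) (w_sum1 : \sum_eta w eta = 1)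
  (w_eta0_gt0 : 0 < w eta0)
  (p_density : forall eta, prob_density (p eta))
  (p_supp : forall eta x, ~ K eta x -> p eta x = 0)
  (K_compact : forall eta, compact (K eta))
  (K_convex : forall eta, convex_set (K eta))
  (K_interior : forall eta, (K eta)° !=set0).
Variable (pmin : R).
Hypotheses (pmin_gt0 : 0 < pmin) (pmin_le : forall u, K eta0 u -> pmin <= p eta0 u).
Variables (g M : R).
Hypotheses (g_gt0 : 0 < g)
  (K_gap : forall eta, eta != eta0 -> forall u v, K eta u -> K eta0 v ->
    g <= dot (u - v) (u - v))
  (K_bound : forall eta u, K eta u -> forall i, `|u ord0 i| <= M).

Local Notation N eta s x := (noised (p eta) s x).
Local Notation m0 s x := (post_mean p eta0 s x).

(** The effect of guidance: a guided step aims at the posterior mean of [eta0] plus [gamma - 1]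
    times this vector. *)
Definition drift s x : 'rV[R]_d := post_mean p eta0 s x - mixture_mean w p s x.

Definition other_prob s x : R :=
  (\sum_(eta | eta != eta0) w eta * noised (p eta) s x) / mixture w p s x.

Let N_gt0 eta s x : 0 < s -> 0 < N eta s x.
Proof. by apply: (noised_gt0 (K := K eta)) => // ?; exact: p_supp. Qed.

Let mix_gt0 s x : 0 < s -> 0 < mixture w p s x.
Proof. by move=> s0; apply: (mixture_gt0 (K := K) (eta0 := eta0)). Qed.

Lemma other_prob_ge0 s x : 0 < s -> 0 <= other_prob s x.
Proof.
move=> s0; rewrite divr_ge0 ?(ltW (mix_gt0 _ _))// sumr_ge0// => eta _.
by rewrite mulr_ge0// ltW// N_gt0.
Qed.

Lemma other_prob_le1 s x : 0 < s -> other_prob s x <= 1.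
Proof.
move=> s0; rewrite ler_pdivrMr ?mix_gt0// mul1r /mixture [leRHS](bigD1 eta0)//=.
by rewrite lerDr mulr_ge0// ltW// N_gt0.
Qed.

(** The [eta0] summand cancels because [m0] is the normalised moment of that label. *)
Lemma driftE s x : 0 < s -> mixture w p s x *: drift s x =
  \sum_(eta | eta != eta0) w eta *: (N eta s x *: m0 s x - moment (p eta) s x).
Proof.
move=> s0; rewrite scalerBr.
have -> : mixture w p s x *: mixture_mean w p s x =
    \sum_eta w eta *: moment (p eta) s x.
  by rewrite scalerA divff ?scale1r// gt_eqF// mix_gt0.
rewrite /mixture scaler_suml -sumrB (bigD1 eta0)//=.
rewrite [X in X + _ = _](_ : _ = 0) ?add0r; last first.
  by rewrite scalerA mulfK ?subrr// gt_eqF ?N_gt0.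
by apply: eq_bigr => eta _; rewrite scalerBr [in RHS]scalerA.
Qed.

Lemma post_mean_K eta s x : 0 < s -> K eta (post_mean p eta s x).
Proof.
move=> s0; apply: post_mean_in => //; last by move=> u; exact: p_supp.
by have [u Ku] := K_interior eta; exists u; exact: interior_subset.
Qed.

(** By [driftE] the drift is a combination, of total weight [other_prob], of differences between
    points of the supports. *)
Lemma drift_coord s x i : 0 < s -> `|drift s x ord0 i| <= 2 * M * other_prob s x.
Proof.
move=> s0; have mx0 := mix_gt0 x s0.
rewrite -(ler_pM2l mx0) -{1}(gtr0_norm mx0) -normrM.
rewrite (_ : _ * drift s x ord0 i = (mixture w p s x *: drift s x) ord0 i); last first.
  by rewrite [RHS]mxE.
rewrite driftE// summxE (le_trans (ler_norm_sum _ _ _))//.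
rewrite /other_prob mulrCA [X in _ * X]mulrC divfK ?gt_eqF// mulrC.
rewrite mulr_suml; apply: ler_sum => eta _.
have -> : moment (p eta) s x = N eta s x *: post_mean p eta s x.
  by rewrite scalerA divff ?scale1r// gt_eqF ?N_gt0.
have := K_bound (post_mean_K eta0 x s0) i; have := K_bound (post_mean_K eta x s0) i.
move: (post_mean p eta s x) (post_mean p eta0 s x) => m m0 hm hm0.
rewrite -scalerBr !mxE !normrM (ger0_norm (w_ge0 _)) gtr0_norm ?N_gt0// mulrA.
rewrite ler_wpM2l ?mulr_ge0 ?(ltW (N_gt0 _ _ _))//.
by rewrite (le_trans (ler_normB _ _))//; lra.
Qed.

(** One factor of [other_prob] is bounded by 1, leaving a bound linear in it like the repulsion term
    that must absorb it. *)
Lemma drift_size s x : 0 < s ->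
  dot (drift s x) (drift s x) <= ((2 * M) ^+ 2 *+ d) * other_prob s x.
Proof.
move=> s0; apply: le_trans (dot_le_coord (fun i => drift_coord x i s0)) _.
rewrite exprMn -mulrnAl ler_wpM2l ?mulrn_wge0 ?sqr_ge0//.
by rewrite expr2 ler_piMl ?other_prob_ge0 ?other_prob_le1.
Qed.

(** [moment_repelled] is summed over the labels other than [eta0], while the obtuse angle condition
    bounds [(y - P).m0] by [(y - P).P]. The errors add up to at most one [c], the weights having sum
    at most 1. *)
Lemma drift_repelled (e Y : R) s y P : 0 < s -> 0 < e ->
  (forall i, `|y ord0 i| <= Y) -> is_projection (K eta0) y P ->
  dot (y - P) (drift s (lam s *: y)) <=
  - (g - e) / 2 * other_prob s (lam s *: y) +
  ((Y + M) ^+ 2 *+ d) / 2 * (gauss_const s (d := d) *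
      expR (- (inv_temp s * (dot (y - P) (y - P) + e)))) /
    mixture w p s (lam s *: y).
Proof.
move=> s0 e0 yY [KP _ Pv]; set x := lam s *: y; set c := _ * (_ * expR _).
have mx0 := mix_gt0 x s0.
have c0 : 0 <= c.
  apply: mulr_ge0; first by rewrite divr_ge0// mulrn_wge0// sqr_ge0.
  by rewrite mulr_ge0 ?expR_ge0// ltW// gauss_const_gt0.
rewrite -(ler_pM2l mx0) -dotZr driftE// dot_sumr.
rewrite mulrDr [X in _ <= _ + X]mulrC divfK ?gt_eqF//.
rewrite [X in _ <= X + _](_ : _ = - (g - e) / 2 *
    (\sum_(eta | eta != eta0) w eta * N eta s x)); last first.
  by rewrite /other_prob mulrCA [X in _ * X]mulrC divfK ?gt_eqF.
have wc : \sum_(eta | eta != eta0) w eta * c <= c.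
  rewrite -mulr_suml ler_piMl// -w_sum1 [leRHS](bigD1 eta0)//= lerDr//.
apply: le_trans (lerD (lexx _) wc).
rewrite mulr_sumr -big_split; apply: ler_sum => eta ne /=.
have := @moment_repelled (p eta) (K eta) s y P g e ((Y + M) ^+ 2 *+ d)
  (@p_density eta) (@K_compact eta) (fun u => @p_supp eta u) s0 (ltW g_gt0) (ltW e0).
rewrite mulrn_wge0 ?sqr_ge0// -/x -/c => /(_ isT).
have K1 u : K eta u -> g <= dot (u - P) (u - P) by move=> Ku; exact: (K_gap ne).
have K2 u : K eta u -> dot (y - u) (y - u) <= (Y + M) ^+ 2 *+ d.
  move=> Ku; apply: dot_le_coord => i; rewrite !mxE (le_trans (ler_normB _ _))//.
  by rewrite lerD// (K_bound Ku).
move=> /(_ K1 K2) h.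
rewrite dotZr dotBr dotZr.
have m0P : dot (y - P) (m0 s x) <= dot (y - P) P.
  by rewrite -subr_le0 -dotBr Pv//; exact: post_mean_K.
have Nm0P : N eta s x * dot (y - P) (m0 s x) <= N eta s x * dot (y - P) P.
  by rewrite ler_pM2l// N_gt0.
rewrite mulrCA -mulrDr ler_wpM2l//; lra.
Qed.

(** A thick set of points of [K eta0] at squared distance at most [D + e / 2] bounds the mixture
    below. The error of [drift_repelled] carries [D + e], so their ratio decays like
    [expR (- q e / 2)], uniformly in [y] in the box. *)
Lemma drift_estimate (e Y : R) : 0 < e ->
  exists2 s0 : R, 0 < s0 & forall s y P, 0 < s -> s < s0 ->
  (forall i, `|y ord0 i| <= Y) -> is_projection (K eta0) y P ->
  dot (y - P) (drift s (lam s *: y)) <=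
  - (g / 2) * other_prob s (lam s *: y) + e.
Proof.
move=> e0; have e20 : 0 < e / 2 by rewrite divr_gt0.
have [c c0 thick] := convex_thick Y (@K_convex eta0) (@K_compact eta0)
  (K_interior eta0) e20.
pose B := (Y + M) ^+ 2 *+ d / 2.
have B0 : 0 <= B by rewrite divr_ge0// mulrn_wge0// sqr_ge0.
have wpc : 0 < w eta0 * pmin * c by rewrite !mulr_gt0.
(* Chosen so that [q >= C] and [z * expR (- z) <= 1] at [z = q * (e / 2)] give [B * expR (- z) <= e
   / 2 * (w eta0 * pmin * c)]. *)
pose C := (4 * (B + 1) / (w eta0 * pmin * c)) / e ^+ 2.
have C0 : 0 < C by rewrite !divr_gt0// ?exprn_gt0// mulr_gt0// ltr_wpDl.
have [s0 s00 s0C] := inv_temp_large C0; exists s0 => // s y P s_gt0 ss0 yY projP.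
apply: le_trans (drift_repelled s_gt0 e0 yY projP) _; rewrite -/B.
set x := lam s *: y; set q := inv_temp s; set D := dot (y - P) (y - P).
have [KP _ _] := projP.
have [S [mS SK muS Sd]] := thick y P yY KP.
have := s0C _ s_gt0 ss0; rewrite -/q => qC.
have k0 := gauss_const_gt0 s_gt0 (d := d).
have q0 := inv_temp_gt0 s_gt0.
have N0 : pmin * (gauss_const s (d := d) * expR (- (q * (D + e / 2)))) * c
    <= N eta0 s x.
  apply: (noised_ge_mass (p_density eta0) (@p_supp eta0) s_gt0 mS muS) => u Su.
  apply: ler_pM.
  - exact: ltW.
  - by rewrite mulr_ge0 ?expR_ge0// ltW.
  - by apply: pmin_le; exact: SK.
  rewrite gauss_kernel_scaled ler_pM2l// ler_expR lerN2 ler_pM2l//.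
  exact: Sd.
have mixN : w eta0 * N eta0 s x <= mixture w p s x.
  rewrite /mixture [leRHS](bigD1 eta0)//= lerDl sumr_ge0// => eta _.
  by rewrite mulr_ge0// ltW// N_gt0.
have mx0 := mix_gt0 x s_gt0.
have X0 : 0 < expR (- (q * (D + e / 2))) by exact: expR_gt0.
(* The other half of [e] pays for replacing [g - e] by [g], as [other_prob] is at most 1. *)
suff : B * (gauss_const s (d := d) * expR (- (q * (D + e)))) / mixture w p s x <= e / 2.
  have := other_prob_ge0 x s_gt0; have := other_prob_le1 x s_gt0.
  move: (other_prob s x) => Q Q1 Q0.
  have : e / 2 * Q <= e / 2 by rewrite ler_piMr// ltW.
  move: (_ / mixture _ _ _ _) => Z; lra.
rewrite ler_pdivrMr//.
have wN : w eta0 * (pmin * (gauss_const s (d := d) *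
    expR (- (q * (D + e / 2)))) * c) <= mixture w p s x.
  by apply: le_trans mixN; rewrite ler_pM2l.
apply: le_trans (_ : e / 2 * (w eta0 * (pmin * (gauss_const s (d := d) *
    expR (- (q * (D + e / 2)))) * c)) <= _); last by rewrite ler_pM2l.
have -> : expR (- (q * (D + e))) =
    expR (- (q * (D + e / 2))) * expR (- (q * (e / 2))).
  by rewrite -expRD; congr expR; lra.
have h : expR (- (q * (e / 2))) * (q * (e / 2)) <= 1.
  rewrite expRN [leLHS]mulrC ler_pdivrMr ?expR_gt0// mul1r.
  by apply: le_trans (expR_ge1Dx _); rewrite lerDr.
set E := expR (- (q * (e / 2))) in h *.
set F := expR (- (q * (D + e / 2))) in X0 *.
have E0 : 0 < E by exact: expR_gt0.
have qE : C * (e / 2) * E <= 1.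
  apply: le_trans h; rewrite [leLHS]mulrC ler_pM2l// ler_pM2r//.
have BE : B * E <= e / 2 * (w eta0 * pmin * c).
  have Ew : C * (e / 2) = 2 * (B + 1) / (w eta0 * pmin * c) / e.
    by rewrite /C; field; rewrite !gt_eqF.
  move: qE; rewrite Ew mulrAC ler_pdivrMr// mul1r mulrAC ler_pdivrMr// => qE.
  have : 0 <= E by exact: ltW.
  lra.
have -> : B * (gauss_const s (d := d) * (F * E)) =
  (gauss_const s (d := d) * F) * (B * E) by ring.
have -> : e / 2 * (w eta0 * (pmin * (gauss_const s (d := d) * F) * c)) =
  (gauss_const s (d := d) * F) * (e / 2 * (w eta0 * pmin * c)) by ring.
by rewrite ler_pM2l// mulr_gt0.
Qed.

End guidance.

(** * Contraction along the schedule *)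

(* Comparing the new point with the same interpolation of [P] and [m], the
   quadratic term in [e] is absorbed by the repulsion term [- g / 2 * Q]. *)
Lemma step_decrease (R : realType) (d : nat) (A : set 'rV[R]_d)
    (y P m e : 'rV[R]_d) (b c g C Q eps : R) :
  convex_set A -> is_projection A y P -> A m -> 0 <= b -> b <= 1 -> 0 <= c ->
  0 <= Q -> 0 <= eps -> dot (y - P) e <= - (g / 2) * Q + eps ->
  dot e e <= C * Q -> b * c * C <= (1 - b) * g ->
  let y' := (1 - b) *: y + b *: (m + c *: e) in
  exists2 P', A P' &
    dot (y' - P') (y' - P') <= (1 - b) * dot (y - P) (y - P) + b * (2 * c * eps).
Proof.
move=> vA [AP _ _] Am b0 b1 c0 Q0 eps0 ve ee bc y'.
have b10 : 0 <= 1 - b by rewrite subr_ge0.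
exists ((1 - b) *: P + (1 - (1 - b)) *: m).
  by apply: convex_set_combination => //; rewrite lerBlDr lerDl.
have -> : y' - ((1 - b) *: P + (1 - (1 - b)) *: m) =
    (1 - b) *: (y - P) + (b * c) *: e.
  by apply/rowP => i; rewrite !mxE; ring.
have := dot_ge0 (y - P); move: (y - P) ve => v ve D0.
rewrite !(dotDl, dotDr, dotZl, dotZr) (dotC e v).
move: (dot v v) (dot v e) (dot e e) D0 ve ee => D ve ee D0 h1 h2.
have bcb : 0 <= b * c by rewrite mulr_ge0.
have g1 : (2 * ((1 - b) * (b * c))) * ve
    <= (2 * ((1 - b) * (b * c))) * (- (g / 2) * Q + eps).
  by rewrite ler_wpM2l// !mulr_ge0.
have g2 : (b * c) ^+ 2 * ee <= (b * c) ^+ 2 * (C * Q).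
  by rewrite ler_wpM2l// sqr_ge0.
have g3 : (b * c * Q) * (b * c * C) <= (b * c * Q) * ((1 - b) * g).
  by rewrite ler_wpM2l// mulr_ge0.
(* [g4] weakens [(1 - b)^2] to [1 - b] in front of [D], and [g5] weakens [1 - b] to 1 in the [eps]
   term. *)
have g4 : 0 <= b * (1 - b) * D by rewrite !mulr_ge0.
have g5 : 0 <= 2 * b * (b * c) * eps by rewrite !mulr_ge0.
lra.
Qed.

(** For error level [e / 2], the constant [e / 2] is a fixed point of the recursion and [c * h]
    dominates its homogeneous part; hence [a <= e / 2 + c * h] propagates from the index where [c]
    is fixed by equality of [a] and [c * h]. *)
Lemma contraction_cvg0 (R : realType) (a b h : nat -> R) :
  (forall k, 0 <= a k) -> (forall k, 0 <= b k) -> (forall k, b k <= 1) ->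
  (forall k, 0 < h k) -> (forall k, (1 - b k) * h k <= h k.+1) ->
  h k @[k --> \oo] --> 0 ->
  (forall e, 0 < e -> \forall k \near \oo, a k.+1 <= (1 - b k) * a k + b k * e) ->
  a k @[k --> \oo] --> 0.
Proof.
move=> a0 b0 b1 h0 hS hcvg aS; apply/cvgr0Pnorm_le => e e0.
have e20 : 0 < e / 2 by rewrite divr_gt0.
have [K _ aK] := aS _ e20.
pose c := a K / h K.
have c0 : 0 <= c by rewrite divr_ge0// ltW.
have bnd n : a (K + n)%N <= e / 2 + c * h (K + n)%N.
  elim: n => [|n IH].
    by rewrite addn0 /c divfK ?gt_eqF// lerDr ltW.
  rewrite addnS; apply: le_trans (aK (K + n)%N (leq_addr _ _)) _.
  have b10 : 0 <= 1 - b (K + n)%N by rewrite subr_ge0.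
  have h1 : (1 - b (K + n)%N) * a (K + n)%N
    <= (1 - b (K + n)%N) * (e / 2 + c * h (K + n)%N) by rewrite ler_wpM2l.
  have h2 : c * ((1 - b (K + n)%N) * h (K + n)%N) <= c * h (K + n).+1.
    by rewrite ler_wpM2l.
  lra.
have d0 : 0 < e / 2 / (c + 1) by rewrite divr_gt0// ltr_wpDl.
have /cvgr0Pnorm_le/(_ _ d0)[K' _ hK'] := hcvg.
exists (K + K')%N => // k /= Kk; rewrite ger0_norm//.
have -> : k = (K + (k - K))%N by rewrite subnKC// (leq_trans (leq_addr _ _) Kk).
apply: le_trans (bnd _) _.
rewrite subnKC ?(leq_trans (leq_addr _ _) Kk)//.
have := hK' k (leq_trans (leq_addl _ _) Kk); rewrite gtr0_norm//= => hk.
have : c * h k <= c * (e / 2 / (c + 1)) by rewrite ler_wpM2l.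
have : c * (e / 2 / (c + 1)) <= e / 2.
  by rewrite mulrCA ler_piMr ?(ltW e20)// ler_pdivrMr ?ltr_wpDl// mul1r lerDl.
lra.
Qed.

(** * Size of the interpolation weights *)

Section step_size.
Context {R : realType}.
Implicit Types s D : R.

Definition step_weight s D : R := (1 - expR (- D)) / sig s ^+ 2.

Let lam_sqr s : lam s ^+ 2 = expR (- (2 * s)).
Proof. by rewrite /lam -expRM_natl mulrN. Qed.

Lemma step_weight_ge0 s D : 0 < s -> 0 <= D -> 0 <= step_weight s D.
Proof.
move=> s0 D0; rewrite divr_ge0 ?(ltW (sig_sqr_gt0 s0))//.
by rewrite subr_ge0 expR_le1 oppr_le0.
Qed.

(** Here [1 - expR (- D) <= D], and [sig s ^+ 2 >= 2s / (1 + 2s) >= 2/3 min(1, s)]. *)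
Lemma step_weight_le s D (kappa : R) : 0 < s -> 0 <= D ->
  D <= kappa * Num.min 1 s -> step_weight s D <= 3 / 2 * kappa.
Proof.
move=> s0 D0 Dk; rewrite ler_pdivrMr ?sig_sqr_gt0//.
have h1 := expR_ge1Dx (- D).
have m0 : 0 < Num.min 1 s by rewrite lt_min ltr01.
have k0 : 0 <= kappa by rewrite -(pmulr_lge0 _ m0); apply: le_trans Dk.
suff h2 : 2 / 3 * Num.min 1 s <= sig s ^+ 2.
  have := ler_wpM2l k0 h2; lra.
rewrite sig_sqr// lam_sqr expRN.
have h3 := expR_ge1Dx (2 * s).
have p1 : 0 < 1 + 2 * s by rewrite addr_gt0// mulr_gt0.
have h4 : (expR (2 * s))^-1 <= (1 + 2 * s)^-1.
  by rewrite lef_pV2 ?posrE ?expR_gt0.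
suff : (1 + 2 * s)^-1 <= 1 - 2 / 3 * Num.min 1 s by lra.
rewrite -div1r ler_pdivrMr//; case: (leP 1 s) => hs; first lra.
have : 0 <= s * (1 - s) by rewrite mulr_ge0// ?subr_ge0 ltW.
lra.
Qed.

(** The factor [expR (ln s / 8)] is [s^(1/8)]. From [1 - expR (- D) >= D / 2] and
    [sig s ^+ 2 <= 2s <= 4(s - D)] the weight is at least [D / (8(s - D))], while
    [ln s - ln (s - D) <= D / (s - D)]. *)
Lemma step_weight_contract s D : 0 < s -> 0 <= D -> D <= 1 -> D <= s - D ->
  0 < s - D ->
  (1 - step_weight s D) * expR (ln s / 8) <= expR (ln (s - D) / 8).
Proof.
move=> s0 D0 D1 Ds sD.
have sg := sig_sqr_gt0 s0.
have h1 : D / 2 <= 1 - expR (- D).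
  rewrite expRN; have h := expR_ge1Dx D.
  have p1 : 0 < 1 + D by rewrite ltr_wpDr.
  have h4 : (expR D)^-1 <= (1 + D)^-1 by rewrite lef_pV2 ?posrE ?expR_gt0.
  suff : (1 + D)^-1 <= 1 - D / 2 by lra.
  rewrite -div1r ler_pdivrMr//.
  have : 0 <= D * (1 - D) by rewrite mulr_ge0// subr_ge0.
  lra.
have h2 : sig s ^+ 2 <= 2 * s.
  by rewrite sig_sqr// lam_sqr; have := expR_ge1Dx (- (2 * s)); lra.
have h3 : D / (8 * (s - D)) <= step_weight s D.
  rewrite ler_pdivlMr// mulrAC ler_pdivrMr ?mulr_gt0//.
  apply: (@le_trans _ _ (D * (4 * (s - D)))).
    by rewrite ler_wpM2l//; lra.
  have := ler_wpM2r (ltW (mulr_gt0 (ltr0n R 8) sD)) h1; lra.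
have h4 : ln s - ln (s - D) <= D / (s - D).
  rewrite -ln_div ?posrE//.
  have -> : s / (s - D) = 1 + D / (s - D) by field; rewrite gt_eqF.
  by apply: le_ln1Dx; rewrite (@lt_le_trans _ _ 0)// divr_ge0// ltW.
have h5 : 1 - step_weight s D <= expR (- step_weight s D) by exact: expR_ge1Dx.
apply: (@le_trans _ _ (expR (- step_weight s D) * expR (ln s / 8))).
  by rewrite ler_pM2r ?expR_gt0.
rewrite -expRD ler_expR.
have : D / (8 * (s - D)) = D / (s - D) / 8 by field; rewrite gt_eqF.
lra.
Qed.

Lemma expR_ln8_cvg0 (s : nat -> R) : (forall k, 0 < s k) ->
  s k @[k --> \oo] --> 0 -> expR (ln (s k) / 8) @[k --> \oo] --> 0.
Proof.
move=> s0 scvg; apply/cvgr0Pnorm_lt => e e0.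
have /cvgr0Pnorm_lt/(_ _ (exprn_gt0 8 e0)) := scvg.
apply: filterS => k; rewrite !gtr0_norm ?expR_gt0// => h.
rewrite -(@ltr_pXn2r _ 8)// ?nnegrE ?expR_ge0 ?(ltW e0)//.
rewrite -expRM_natl; have -> : 8 * (ln (s k) / 8) = ln (s k) by field.
by rewrite lnK ?posrE.
Qed.

End step_size.

Lemma norm_interpolation_le (R : realDomainType) (b x z Y : R) :
  0 <= b -> b <= 1 -> `|x| <= Y -> `|z| <= Y -> `|(1 - b) * x + b * z| <= Y.
Proof.
move=> b0 b1 xY zY; have b10 : 0 <= 1 - b by rewrite subr_ge0.
rewrite (le_trans (ler_normD _ _))// !normrM (ger0_norm b0) (ger0_norm b10).
have := ler_wpM2l b0 zY; have := ler_wpM2l b10 xY; lra.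
Qed.

(** [finite_uniform_gt0] produces small constants, so it is applied to the inverses of the
    bounds. *)
Lemma family_coord_bounded (R : realType) (d : nat) (J : finType)
    (K : J -> set 'rV[R]_d) : (forall j, compact (K j)) ->
  exists2 M : R, 0 < M & forall j u, K j u -> forall i, `|u ord0 i| <= M.
Proof.
move=> cK.
have [|j|a a0 Ka] := @finite_uniform_gt0 R J
  (fun j a => forall u, K j u -> forall i, `|u ord0 i| <= a^-1).
- move=> j a b Ka b0 ba u Ku i; apply: le_trans (Ka u Ku i) _.
  by rewrite lef_pV2// posrE (lt_le_trans b0).
- have [B B0 KB] := compact_coord_bounded (cK j).
  by exists B^-1; rewrite ?invr_gt0// invrK.
- by exists a^-1; rewrite ?invr_gt0.
Qed.

Lemma family_gap (R : realType) (d : nat) (J : finType)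
    (K : J -> set 'rV[R]_d) j0 : (forall j, compact (K j)) ->
  (forall j j', j != j' -> K j `&` K j' = set0) ->
  exists2 g : R, 0 < g & forall j, j != j0 -> forall u v, K j u -> K j0 v ->
    g <= dot (u - v) (u - v).
Proof.
move=> cK dK; apply: (@finite_uniform_gt0 R J (fun j g => j != j0 ->
    forall u v, K j u -> K j0 v -> g <= dot (u - v) (u - v))).
  by move=> j a b Ka _ ba ne u v Ku Kv; apply: le_trans ba _; exact: Ka.
move=> j; have [->|ne] := eqVneq j j0; first by exists 1.
by have [g g0 Kg] := compact_gap (cK j) (cK j0) (dK _ _ ne); exists g.
Qed.

(** * Convergence of the guided iterates *)

Unset Implicit Arguments.

Theorem theorem3p2 (R : realType) (d : nat) (d_ge1 : (1 <= d)%N)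
    (I : finType) (eta0 : I)
    (w : I -> R) (p : I -> 'rV[R]_d -> R) (K : I -> set 'rV[R]_d)
    (w_ge0 : forall eta, 0 <= w eta)
    (w_sum1 : \sum_eta w eta = 1)
    (w_eta0_gt0 : 0 < w eta0)
    (p_density : forall eta, prob_density (p eta))
    (p_supp : forall eta x, ~ K eta x -> p eta x = 0)
    (K_convex : forall eta, convex_set (K eta))
    (K_compact : forall eta, compact (K eta))
    (K_interior : forall eta, (K eta)° !=set0)
    (K_disjoint : forall eta eta', eta != eta' -> K eta `&` K eta' = set0)
    (p_eta0_inf : 0 < inf [set p eta0 x | x in K eta0])
    (gamma : R) (gamma_ge1 : 1 <= gamma) :
  exists2 kappa0 : R, 0 < kappa0 &
    forall (T : R), 0 < T ->
    forall kappa : R, 0 < kappa < 1 -> kappa <= kappa0 ->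
    forall t : nat -> R,
      t 0%N = 0 ->
      (forall k, 0 <= t k < t k.+1) ->
      (forall k, t k.+1 < T) ->
      t k @[k --> \oo] --> T ->
      (forall k, t k.+1 - t k <= kappa * Num.min 1 (T - t k.+1)) ->
    forall xhat : nat -> 'rV[R]_d,
      (forall k, xhat k.+1 =
         expR (t k.+1 - t k) *: xhat k +
         (expR (t k.+1 - t k) - 1) *:
           (grad (fun x => ln (mixture w p (T - t k) x)) (xhat k) +
            gamma *:
              grad (fun x => ln (posterior w p eta0 (T - t k) x)) (xhat k))) ->
    edistance (xhat k) (K eta0) @[k --> \oo] --> 0.
Proof.
have c0 : 0 <= gamma - 1 by rewrite subr_ge0.
have K0 eta : K eta !=set0.
  by have [u Ku] := K_interior eta; exists u; exact: interior_subset.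
have [M M0 KM] := family_coord_bounded K_compact.
have [g g0 Kg] := family_gap eta0 K_compact K_disjoint.
have p_le u : K eta0 u -> inf [set p eta0 x | x in K eta0] <= p eta0 u.
  move=> Ku; apply: ge_inf; last by exists u.
  by exists 0 => _ [z _ <-]; case: (p_density eta0).
pose C := (2 * M) ^+ 2 *+ d.
have C0 : 0 <= C by rewrite mulrn_wge0// sqr_ge0.
have cC0 : 0 <= (gamma - 1) * C by rewrite mulr_ge0.
have cCg0 : 0 < (gamma - 1) * C + g by rewrite ltr_wpDl.
(* As [b k <= 3 / 2 * kappa], this forces [b k * ((gamma - 1) * C + g) <= g], which is the smallness
   condition of [step_decrease] and also gives [b k <= 1]. *)
exists (2 / 3 * (g / ((gamma - 1) * C + g))); first by rewrite mulr_gt0// divr_gt0.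
move=> T T0 kappa /andP[kappa_gt0 kappa_lt1] kappa_le t t00 tmono tT tcvg tstep xhat xstep.
pose s k := T - t k; pose D k := t k.+1 - t k.
have sS k : s k.+1 = s k - D k by rewrite /s /D; lra.
have s0 k : 0 < s k.
  have /andP[_ tk] := tmono k; rewrite subr_gt0; exact: lt_trans (tT k).
have D0 k : 0 <= D k by have /andP[_ /ltW] := tmono k; rewrite -subr_ge0.
have Dmin k : D k <= kappa * Num.min 1 (s k.+1) := tstep k.
have D1 k : D k <= 1.
  apply: le_trans (Dmin k) _; rewrite -[leRHS]mulr1 -[X in _ <= X * _]mul1r.
  rewrite mul1r ler_pM ?(ltW kappa_gt0) ?(ltW kappa_lt1)//.
    by rewrite le_min ler01 ltW.
  by rewrite ge_min lexx.
have Ds k : D k <= s k - D k.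
  rewrite -sS; apply: le_trans (Dmin k) _; rewrite -[leRHS]mul1r.
  rewrite ler_pM ?(ltW kappa_gt0) ?(ltW kappa_lt1)//.
    by rewrite le_min ler01 ltW.
  by rewrite ge_min lexx orbT.
pose b k := step_weight (s k) (D k).
have b0 k : 0 <= b k by exact: step_weight_ge0.
have bk k : b k <= g / ((gamma - 1) * C + g).
  have : b k <= 3 / 2 * kappa.
    apply: step_weight_le => //; apply: le_trans (Dmin k) _.
    have ss : s k.+1 <= s k by rewrite sS lerBlDr lerDl.
    by rewrite ler_pM2l// le_min !ge_min lexx ss orbT.
  lra.
have bcC k : b k * ((gamma - 1) * C + g) <= g by rewrite -ler_pdivlMr.
have b1 k : b k <= 1.
  by apply: le_trans (bk k) _; rewrite ler_pdivrMr// mul1r lerDr.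
pose y k := expR (s k) *: xhat k.
have xy k : xhat k = lam (s k) *: y k.
  by rewrite scalerA /lam expRN mulVf ?scale1r// gt_eqF// expR_gt0.
pose m k := post_mean p eta0 (s k) (xhat k).
pose e k := drift w p eta0 (s k) (xhat k).
have yS k : y k.+1 = (1 - b k) *: y k + b k *: (m k + (gamma - 1) *: e k).
  rewrite /y xstep sS.
  exact: (guided_step w_ge0 w_eta0_gt0 p_density p_supp K_compact).
have yC k i : y k.+1 ord0 i = (1 - b k) * y k ord0 i +
    b k * (m k ord0 i + (gamma - 1) * e k ord0 i).
  by rewrite yS; move: (m k) (e k) (y k) => m1 e1 y1; rewrite !mxE.
have mK k : K eta0 (m k).
  exact: (post_mean_K p_density p_supp K_compact K_convex K_interior).
(* Each new [y] interpolates the old one and a target bounded by [M + (gamma - 1) * (2 * M)]. The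
   resulting fixed box lets one threshold [s1] serve the whole trajectory. *)
have [Y yY] : exists Y, forall k i, `|y k ord0 i| <= Y.
  pose Y := \sum_i `|y 0%N ord0 i| + (M + (gamma - 1) * (2 * M)).
  have M2 : M + (gamma - 1) * (2 * M) <= Y by rewrite lerDr sumr_ge0.
  exists Y; elim=> [|k IH] i.
    rewrite /Y (bigD1 i)//= -addrA lerDl addr_ge0 ?sumr_ge0//.
    by rewrite addr_ge0 ?(ltW M0)// !mulr_ge0// ltW.
  rewrite yC; apply: norm_interpolation_le => //.
  apply: le_trans M2; rewrite (le_trans (ler_normD _ _))// lerD ?(KM _ _ (mK k))//.
  rewrite normrM ger0_norm// ler_wpM2l//.
  apply: le_trans (drift_coord w_ge0 w_eta0_gt0 p_density p_supp K_compact
      K_convex K_interior KM (xhat k) i (s0 k)) _.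
  rewrite ler_piMr ?mulr_ge0 ?(ltW M0)//.
  exact: (other_prob_le1 w_ge0 w_eta0_gt0 p_density p_supp K_compact).
have /choice[P projP] k : exists P, is_projection (K eta0) (y k) P.
  exact: projection_exists.
pose a k := dot (y k - P k) (y k - P k).
have scvg : s k @[k --> \oo] --> 0.
  by rewrite -(subrr T); apply: cvgB => //; exact: cvg_cst.
have acvg : a k @[k --> \oo] --> 0.
  apply: (@contraction_cvg0 _ a b (fun k => expR (ln (s k) / 8))) => //.
  - by move=> k; exact: dot_ge0.
  - by move=> k; exact: expR_gt0.
  - by move=> k; rewrite sS; apply: step_weight_contract => //; rewrite -sS.
  - exact: expR_ln8_cvg0.
  move=> eps eps0.
  (* Ensures [2 * (gamma - 1) * eps' <= eps]; the added 1 covers [gamma = 1]. *)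
  pose eps' := eps / (2 * (gamma - 1) + 1).
  have g21 : 0 < 2 * (gamma - 1) + 1 by rewrite ltr_wpDl// mulr_ge0.
  have eps'0 : 0 < eps' by rewrite divr_gt0.
  have [s1 s10 H] := drift_estimate w_ge0 w_sum1 w_eta0_gt0 p_density p_supp
    K_compact K_convex K_interior p_eta0_inf p_le g0 Kg KM Y eps'0.
  have /cvgr0Pnorm_lt/(_ _ s10) := scvg.
  apply: filterS => k; rewrite gtr0_norm// => sk.
  have := H (s k) (y k) (P k) (s0 k) sk (yY k) (projP k); rewrite -xy -/(e k) => He.
  have Q0 := other_prob_ge0 w_ge0 w_eta0_gt0 p_density p_supp K_compact (xhat k) (s0 k).
  have ee := drift_size w_ge0 w_eta0_gt0 p_density p_supp K_compact K_convex
    K_interior KM (xhat k) (s0 k).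
  have bg : b k * (gamma - 1) * C <= (1 - b k) * g by have := bcC k; lra.
  have [P' KP' hP'] := step_decrease (K_convex eta0) (projP k) (mK k) (b0 k) (b1 k)
    c0 Q0 (ltW eps'0) He ee bg.
  (* The new projection is at least as close to [y k.+1] as the comparison point [P']. *)
  have [_ Pmin _] := projP k.+1.
  apply: le_trans (Pmin _ KP') _; rewrite yS; apply: le_trans hP' _.
  rewrite lerD2l ler_wpM2l// /eps' mulrA ler_pdivrMr//.
  by rewrite mulrC ler_pM2l// lerDl.
have ls k : 0 <= 1 - lam (s k) <= s k.
  have := expR_ge1Dx (- s k); have := lam_lt1 (s0 k); rewrite /lam => h1 h2.
  by apply/andP; split; lra.
(* Return from [y] to [xhat = lam *: y]: the rescaling moves the point by [(1 - lam) *: y], with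
   [1 - lam <= s] and [y] in the box. *)
pose r k := 2 * (s k * s k * (Y ^+ 2 *+ d)) + 2 * a k.
have rcvg : Num.sqrt (r k) @[k --> \oo] --> 0.
  have : r k @[k --> \oo] --> 2 * (0 * 0 * (Y ^+ 2 *+ d)) + 2 * (0 : R).
    apply: cvgD; apply: cvgM => //; try exact: cvg_cst.
    by apply: cvgM; [exact: cvgM|exact: cvg_cst].
  rewrite mul0r mul0r mulr0 addr0 => r0.
  rewrite -sqrtr0; apply: continuous_cvg => //; exact: sqrt_continuous.
have eb k : 0 <= edistance (xhat k) (K eta0) <= Num.sqrt (r k).
  have lbE : has_lbound [set enorm (xhat k - z) | z in K eta0].
    by exists 0 => _ [z _ <-]; rewrite enormE sqrtr_ge0.
  apply/andP; split.
    apply: lb_le_inf; last by move=> _ [z _ <-]; rewrite enormE sqrtr_ge0.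
    by have [z Kz] := K0 eta0; exists (enorm (xhat k - z)); exists z.
  have [KP _ _] := projP k.
  apply: (@le_trans _ _ (enorm (xhat k - P k))).
    by apply: ge_inf => //; exists (P k).
  rewrite enormE ler_wsqrtr//.
  have -> : xhat k - P k = - (1 - lam (s k)) *: y k + (y k - P k).
    by rewrite {1}xy; apply/rowP => i; rewrite !mxE; ring.
  apply: le_trans (dotDD_le _ _) _; rewrite lerD2r ler_pM2l// dotZl dotZr.
  have /andP[l0 l1] := ls k.
  rewrite mulrA mulrNN; apply: ler_pM; rewrite ?mulr_ge0 ?dot_ge0//.
    by apply: ler_pM.
  exact: dot_le_coord.
apply: (@squeeze_cvgr _ _ _ _ (cst 0) (fun k => Num.sqrt (r k))) => //.
- exact: nearW.
- exact: cvg_cst.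
Qed.
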